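(* Let $K$ be an infinite field, let $\mathcal O$ be the local ring of a plane algebroid curve over $K$ with $d$ branches, and suppose that its blow-up $\mathcal B(\mathcal O)$ is not local. Let $\omega=(\omega_1,\dots,\omega_d)$ be the minimal nonzero element of $v(\mathcal O)$, and let $N=\omega_1+\cdots+\omega_d$. Let $A_i$ and $A_i'$ ($0\le i\le N-1$) denote the $i$-th levels of the Apéry sets with respect to $\omega$ of $v(\mathcal O)$ and of $v(\mathcal B(\mathcal O))$, respectively. Then, for every $i=0,\dots,N-1$, $$A_i=A_i'+i\,\omega .$$
   Context: Rings and values. A plane algebroid curve over $K$ is a ring $\mathcal O=K[[X,Y]]/(H_1\cdots H_d)$ with $H_1,\dots,H_d$ irreducible and pairwise coprime; its branches are $K[[X,Y]]/(H_i)$. The integral closure of each branch is a power series ring $K[[t_i]]$, so $\mathcal O$ and $\mathcal B(\mathcal O)$ have the common integral closure $K[[t_1]]\times\cdots\times K[[t_d]]$, and the local factors of $\mathcal B(\mathcal O)$ have residue field $K$. For a non-zero-divisor $g$, $v(g)\in\mathbb N^d$ is the vector of orders in $t_1,\dots,t_d$; for a ring $R$ among these, $v(R)$ is the set of values of its non-zero-divisors. The blow-up of $(\mathcal O,\mathfrak m)$ is $\mathcal B(\mathcal O)=\bigcup_n(\mathfrak m^n:\mathfrak m^n)$ inside the total ring of fractions; if $\mathfrak m=(x,y)$ with $v(x)$ minimal among values of elements of $\mathfrak m$, it equals $\mathcal O[y/x]$. Orders. On $\mathbb N^d$, $\le$ is the componentwise order, $\alpha\wedge\beta$ is the componentwise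 minimum, and $\alpha\le\le\beta$ means that $\alpha=\beta$ or $\alpha_i<\beta_i$ for all $i$. For $U\subseteq\{1,\dots,d\}$ and $S\subseteq\mathbb N^d$, $\Delta^S_U(\alpha)=\{\beta\in S:\beta_i=\alpha_i \text{ for } i\in U,\ \beta_j>\alpha_j\text{ for } j\notin U\}$. Levels. Let $S$ be one of the two value semigroups. The Apéry set of $S$ with respect to $\omega$ is $A=S\setminus(\omega+S)$. An element $\alpha$ of $B\subseteq S$ is a complete infimum of $\beta^{(1)},\dots,\beta^{(r)}\in B$ ($r\ge2$) if $\beta^{(j)}\in\Delta^S_{F_j}(\alpha)$ for some nonempty $F_j\subsetneq\{1,\dots,d\}$, $\alpha=\beta^{(j)}\wedge\beta^{(k)}$ for all $j\ne k$, and $\bigcap_k F_k=\emptyset$. Define inductively for $i\ge1$: $B^{(i)}$ is the set of elements of $A\setminus\bigcup_{j<i}D^{(j)}$ maximal with respect to $\le\le$; $C^{(i)}$ is the set of $\alpha\in B^{(i)}$ that are complete infimum of some $\beta^{(1)},\dots,\beta^{(r)}\in B^{(i)}$ with $1<r\le d$; $D^{(i)}=B^{(i)}\setminus C^{(i)}$. Then $A$ is the disjoint union of $D^{(1)},\dots,D^{(N)}$ with (known fact) $N=\omega_1+\cdots+\omega_d$, and the $i$-th level of $A$ is $D^{(N-i)}$, $0\le i\le N-1$. *)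

(* Defs.v *)
From HB Require Import structures.
From mathcomp Require Import all_boot all_order all_algebra.
From mathcomp Require Import boolp classical_sets cardinality.

Set Implicit Arguments.
Unset Strict Implicit.
Unset Printing Implicit Defensive.

Import GRing.Theory.

Local Open Scope ring_scope.
Local Open Scope classical_set_scope.

(** * Formal power series *)

Record fps (R : Type) := Fps { fcoef : nat -> R }.

HB.instance Definition _ (R : Type) := gen_eqMixin (fps R).
HB.instance Definition _ (R : Type) := gen_choiceMixin (fps R).

Lemma fpsP (R : Type) (f g : fps R) : (forall n, fcoef f n = fcoef g n) -> f = g.
Proof. by case: f g => [f] [g] /= fg; congr Fps; apply/funext. Qed.

Section FpsZmod.
Variable R : comNzRingType.
Implicit Types f g h : fps R.

Definition fps0 : fps R := Fps (fun _ => 0).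
Definition fpsN f : fps R := Fps (fun n => - fcoef f n).
Definition fpsD f g : fps R := Fps (fun n => fcoef f n + fcoef g n).

Lemma fpsDA : associative fpsD.
Proof. by move=> f g h; apply: fpsP => n /=; rewrite addrA. Qed.
Lemma fpsDC : commutative fpsD.
Proof. by move=> f g; apply: fpsP => n /=; rewrite addrC. Qed.
Lemma fps0D : left_id fps0 fpsD.
Proof. by move=> f; apply: fpsP => n /=; rewrite add0r. Qed.
Lemma fpsND : left_inverse fps0 fpsN fpsD.
Proof. by move=> f; apply: fpsP => n /=; rewrite addNr. Qed.

HB.instance Definition _ :=
  GRing.isZmodule.Build (fps R) fpsDA fpsDC fps0D fpsND.

Definition fpsC (c : R) : fps R := Fps (fun n => if n == 0%N then c else 0).

Definition fpsM f g : fps R :=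
  Fps (fun n => \sum_(i < n.+1) fcoef f i * fcoef g (n - i)).

Let trunc n f : {poly R} := \poly_(i < n.+1) fcoef f i.

Let coef_trunc n f i : (i <= n)%N -> (trunc n f)`_i = fcoef f i.
Proof. by move=> lin; rewrite coef_poly ltnS lin. Qed.

Let coefM_trunc n f g i : (i <= n)%N ->
  fcoef (fpsM f g) i = (trunc n f * trunc n g)`_i.
Proof.
move=> lin; rewrite coefM; apply: eq_bigr => j _.
have lji : (j <= i)%N by rewrite -ltnS.
have lijn : (i - j <= n)%N := leq_trans (leq_subr j i) lin.
by rewrite (coef_trunc f (leq_trans lji lin)) (coef_trunc g lijn).
Qed.

Lemma fpsMC : commutative fpsM.
Proof. by move=> f g; apply: fpsP => n; rewrite (coefM_trunc f g (leqnn n)) mulrC -coefM_trunc. Qed.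

Lemma fpsMA : associative fpsM.
Proof.
move=> f g h; apply: fpsP => n.
transitivity (trunc n f * trunc n g * trunc n h)`_n.
  rewrite -mulrA coefM; apply: eq_bigr => i _.
  have lin : (i <= n)%N by rewrite -ltnS.
  by rewrite (coef_trunc f lin) (coefM_trunc g h (leq_subr i n)).
rewrite coefM; apply: eq_bigr => i _.
have lin : (i <= n)%N by rewrite -ltnS.
by rewrite (coefM_trunc f g lin) (coef_trunc h (leq_subr i n)).
Qed.

Lemma fps1M : left_id (fpsC 1) fpsM.
Proof.
move=> f; apply: fpsP => n /=; rewrite big_ord_recl /= mul1r subn0.
by rewrite big1 ?addr0 // => i _; rewrite mul0r.
Qed.

Lemma fpsMDl : left_distributive fpsM fpsD.
Proof.
move=> f g h; apply: fpsP => n /=; rewrite -big_split.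
by apply: eq_bigr => i _; rewrite mulrDl.
Qed.

Lemma fps1_neq0 : fpsC 1 != 0.
Proof.
by apply/eqP => /(congr1 (fun f => fcoef f 0)) /= /eqP; rewrite oner_eq0.
Qed.

HB.instance Definition _ := GRing.Zmodule_isComNzRing.Build (fps R)
  fpsMA fpsMC fps1M fpsMDl fps1_neq0.

Definition fps_unit : {pred fps R} := fun f => `[< exists g, g * f = 1 >].
Definition fps_inv f : fps R :=
  if pselect (exists g, g * f = 1) is left ex then projT1 (cid ex) else f.

Lemma fps_mulVr : {in fps_unit, left_inverse 1 fps_inv *%R}.
Proof.
move=> f /asboolP uf; rewrite /fps_inv.
by case: pselect => // ex; case: (cid ex).
Qed.
Lemma fps_unitPl f g : g * f = 1 -> fps_unit f.
Proof. by move=> gf; apply/asboolP; exists g. Qed.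
Lemma fps_inv_out : {in [predC fps_unit], fps_inv =1 id}.
Proof.
move=> f /negP nuf; rewrite /fps_inv; case: pselect => // ex.
by case: nuf; apply/asboolP.
Qed.

HB.instance Definition _ := GRing.ComNzRing_hasMulInverse.Build (fps R)
  fps_mulVr fps_unitPl fps_inv_out.

(* [n] is the order (lowest exponent of a nonzero term) of [f]. *)
Definition has_order f (n : nat) : Prop :=
  fcoef f n <> 0 /\ forall i, (i < n)%N -> fcoef f i = 0.

Lemma has_order_ex f : f != 0 -> exists n, has_order f n.
Proof.
move=> f0; have ex : exists n, fcoef f n != 0.
  apply: contrapT => nex; case/eqP: f0; apply: fpsP => n.
  by apply/eqP; apply: contrapT => fn; apply: nex; exists n; apply/negP.
case: (ex_minnP ex) => n fn min_n; exists n; split; first exact/eqP.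
by move=> i lin; apply/eqP; apply: contraTT lin => fi; rewrite -leqNgt min_n.
Qed.

End FpsZmod.

Section FpsIdomain.
Variable R : idomainType.

Lemma fps_idomain : GRing.integral_domain_axiom (fps R).
Proof.
move=> f g fg0; apply: contrapT => /negP; rewrite negb_or => /andP[].
move=> /has_order_ex[m [fm ltm]] /has_order_ex[n [gn ltn]].
have := congr1 (fun h => fcoef h (m + n)) fg0 => /=.
have lm : (m < (m + n).+1)%N by rewrite ltnS leq_addr.
rewrite (bigD1 (Ordinal lm)) //= addKn big1 => [/eqP|i].
  by rewrite addr0 mulf_eq0 => /orP[] /eqP.
rewrite -val_eqE /= neq_ltn => /orP[lim|lmi]; first by rewrite (ltm _ lim) mul0r.
have lji : (m + n - i < n)%N.
  by rewrite ltn_subLR ?ltn_add2r // -ltnS; exact: ltn_ord.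
by rewrite (ltn _ lji) mulr0.
Qed.

HB.instance Definition _ := GRing.ComUnitRing_isIntegral.Build (fps R) fps_idomain.

End FpsIdomain.

(* K[[X,Y]] is built as K[[X]][[Y]]. *)
Notation fps2 K := (fps (fps K)).

(* The field K((t)) of Laurent series, as the fraction field of K[[t]]. *)
Notation laurent K := {fraction fps K}.

Notation "x %:F" := (FracField.tofrac x) : ring_scope.

(** * Commutative algebra *)

Section Divisibility.
Variable R : comUnitRingType.
Implicit Types a b c : R.

Definition divides a b : Prop := exists c, b = c * a.

Definition irreducible_elt a : Prop :=
  [/\ a != 0, a \isn't a GRing.unit &
      forall b c, a = b * c -> b \is a GRing.unit \/ c \is a GRing.unit].

Definition coprime_elt a b : Prop :=
  forall c, divides c a -> divides c b -> c \is a GRing.unit.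

End Divisibility.

(* Rings between [O] and its total ring of fractions, and their ideals, are
   handled as subsets of the total ring of fractions [Q]. *)
Section Subrings.
Variable Q : comUnitRingType.
Implicit Types R I J M : set Q.

Definition regular_in R (q : Q) : Prop := forall r, R r -> q * r = 0 -> r = 0.

Definition ideal_of R I : Prop :=
  [/\ I `<=` R, I 0, forall x y, I x -> I y -> I (x + y) &
      forall r x, R r -> I x -> I (r * x)].

Definition maximal_ideal R M : Prop :=
  [/\ ideal_of R M, M <> R &
      forall I, ideal_of R I -> M `<=` I -> I = M \/ I = R].

Definition local_ring R : Prop := exists! M, maximal_ideal R M.

Definition ideal_mul I J : set Q :=
  [set x | exists (n : nat) (a b : 'I_n -> Q),
     (forall k, I (a k) /\ J (b k)) /\ x = \sum_(k < n) a k * b k].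

Fixpoint ideal_pow R I (n : nat) : set Q :=
  if n is n'.+1 then ideal_mul I (ideal_pow R I n') else R.

Definition colon I J : set Q := [set q | forall x, J x -> I (q * x)].

Definition blowup R M : set Q :=
  \bigcup_n colon (ideal_pow R M n) (ideal_pow R M n).

End Subrings.

Definition total_fraction_ring (O : comNzRingType) (Q : comUnitRingType)
    (iota : {rmorphism O -> Q}) : Prop :=
  [/\ injective iota,
      forall a, GRing.lreg a -> iota a \is a GRing.unit &
      forall q, exists a b, GRing.lreg b /\ q = iota a / iota b].

(** * Plane algebroid curves *)

(* [O], through [pi], is the ring K[[X,Y]]/(H_1 ... H_d). *)
Definition plane_algebroid_curve (K : fieldType) (d : nat) (H : 'I_d -> fps2 K)
    (O : comNzRingType) (pi : {rmorphism fps2 K -> O}) : Prop :=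
  [/\ forall i, irreducible_elt (H i),
      forall i j, i != j -> coprime_elt (H i) (H j),
      forall a, exists f, pi f = a &
      forall f, pi f = 0 <-> divides (\prod_(i < d) H i) f].

(* Through [phi], which identifies the branch K[[X,Y]]/(h) with a
   K-subalgebra of K[[t]], the field K((t)) is the field of fractions of the
   branch and K[[t]] is the integral closure of the branch in that field. *)
Definition branch_normalization (K : fieldType) (h : fps2 K)
    (phi : {rmorphism fps2 K -> fps K}) : Prop :=
  [/\ forall c : K, phi (fpsC (fpsC c)) = fpsC c,
      forall f, phi f = 0 <-> divides h f,
      forall z : laurent K, exists f g,
        phi g != 0 /\ z = (phi f)%:F / (phi g)%:F &
      forall z : laurent K,
        integralOver (fun f => (phi f)%:F) z <-> exists s : fps K, z = s%:F].

Section Values.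
Variables (K : fieldType) (d : nat) (Q : comUnitRingType).
Variable psi : forall i : 'I_d, {rmorphism Q -> laurent K}.

(* [psi i] being the projection from [Q] to the i-th factor K((t_i)), the
   element [q] lies in K[[t_1]] x ... x K[[t_d]] and has orders [alpha]. *)
Definition has_value (q : Q) (alpha : {ffun 'I_d -> nat}) : Prop :=
  forall i, exists s : fps K, psi i q = s%:F /\ has_order s (alpha i).

Definition value_semigroup (R : set Q) : set {ffun 'I_d -> nat} :=
  [set alpha | exists q, [/\ R q, regular_in R q & has_value q alpha]].

End Values.

(** * Apery sets and their levels *)

Section Levels.
Variable d : nat.
Local Notation Nd := {ffun 'I_d -> nat}.
Implicit Types (alpha beta omega : Nd) (S X : set Nd) (U : {set 'I_d}).

Definition cw_le alpha beta : Prop := forall i, (alpha i <= beta i)%N.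

Definition cw_min alpha beta : Nd := [ffun i => minn (alpha i) (beta i)].

Definition lele alpha beta : Prop :=
  alpha = beta \/ forall i, (alpha i < beta i)%N.

Definition Delta S U alpha : set Nd :=
  [set beta | [/\ S beta, forall i, i \in U -> beta i = alpha i &
                  forall j, j \notin U -> (alpha j < beta j)%N]].

Definition minimal_nonzero S omega : Prop :=
  [/\ S omega, omega <> 0 &
      forall alpha, S alpha -> alpha <> 0 -> cw_le alpha omega ->
        alpha = omega].

Definition apery S omega : set Nd :=
  S `\` [set omega + sigma | sigma in S].

Definition complete_infimum S alpha (r : nat) (beta : 'I_r -> Nd) : Prop :=
  exists F : 'I_r -> {set 'I_d},
    [/\ forall j, F j != finset.set0 /\ F j \proper [set: 'I_d]%SET,
        forall j, Delta S (F j) alpha (beta j),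
        forall j k, j != k -> alpha = cw_min (beta j) (beta k) &
        (\bigcap_(k < r) F k)%SET = finset.set0].

(* For [X] the part of the Apery set left after removing the D^(j) with j < i,
   the next three definitions are B^(i), C^(i) and D^(i). *)
Definition Bpart X : set Nd :=
  [set alpha | X alpha /\ forall beta, X beta -> lele alpha beta -> beta = alpha].

Definition Cpart S X : set Nd :=
  [set alpha | Bpart X alpha /\
     exists (r : nat) (beta : 'I_r -> Nd),
       [/\ (1 < r <= d)%N, forall j, Bpart X (beta j) &
           complete_infimum S alpha beta]].

Definition Dpart S X : set Nd := Bpart X `\` Cpart S X.

(* The union of D^(1), ..., D^(i). *)
Fixpoint Dunion S omega (i : nat) : set Nd :=
  if i is i'.+1 then
    Dunion S omega i' `|` Dpart S (apery S omega `\` Dunion S omega i')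
  else classical_sets.set0.

(* D^(i), for i >= 1. *)
Definition Dset S omega (i : nat) : set Nd :=
  Dpart S (apery S omega `\` Dunion S omega i.-1).

Definition level S omega (i : nat) : set Nd :=
  Dset S omega (\sum_(k < d) omega k - i)%N.

End Levels.

(* Main.v *)
Require Import Defs.
From HB Require Import structures.
From mathcomp Require Import all_boot all_order all_algebra.
From mathcomp Require Import boolp classical_sets cardinality.
From mathcomp Require Import zify ring.

(* Let x in m have the minimal value omega, let y be a second generator of m and
   z = y/x, so that O = K[[x]][y] and B(O) = K[[x]][z].  Let R be either ring,
   N = omega_1 + ... + omega_d, R(a) the ideal of elements of value at least a,
   and lam_R(a) the least degree of a monic polynomial over K[[x]], in y
   respectively z, whose value is at least a; this is the codimension of
   R(a) + xR in R.

   Raising the l-th coordinate of a by one raises lam_R by one exactly when some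
   element of R, but none of xR, has value at least a with l-th coordinate a_l.
   From this rule alone it follows that the i-th level of the Apery set consists of
   its elements a with lam_R(a) = i: once the levels above i are removed, an element
   a with lam_R(a) < i is either not maximal or the complete infimum of elements
   obtained by raising a along the parts of a partition of the indices.

   An element a of the i-th level is the exact value of a monic polynomial of
   degree i.  If g is monic of degree i in z then x^i g(y/x) is monic of degree i
   in y.  Conversely a monic f of degree i in y is x^c g(y/x) with g nonzero modulo
   x of degree at most c, and c < i would make lam_O smaller than i at the value
   of f. *)

(** Both rings are images of one polynomial ring K[[x]][T], under evaluation at y and at z, and p
    evaluated at y is p(xT) evaluated at z; so they are compared on polynomials. The working
    principle is that the degree modulo x of any element of R(a) bounds lam_R(a), so an element may
    be corrected by multiples of x although these can spoil monicity.

    Only elements without zero component have values; the conductor repairs zero components and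
    leaves the others alone, so any element may witness a jump. The field is infinite so that one
    scalar avoids cancellation on all branches at once: in the choice of x, in minima of values, and
    in passing from a bound on the value of a monic polynomial to an exact value.

    The number N enters as the rank of R over K[[x]]: far out, moving a by omega raises the
    codimension of R(a) by N, and a telescoping sum shows that it raises it by the rank. *)

Set Implicit Arguments.
Unset Strict Implicit.
Unset Printing Implicit Defensive.

Import GRing.Theory.

Local Open Scope ring_scope.
Local Open Scope classical_set_scope.

(** * Levels and jumps *)

Section Jumps.
Variable d : nat.
Local Notation Nd := {ffun 'I_d -> nat}.
Implicit Types (a b s : Nd) (S X : set Nd) (J G : {set 'I_d}).

Lemma ffnatD a b l : (a + b) l = (a l + b l)%N.
Proof. by rewrite ffunE. Qed.

Lemma ffnatMn a n l : (a *+ n) l = (a l * n)%N.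
Proof.
elim: n => [|n IH]; first by rewrite mulr0n ffunE muln0.
by rewrite mulrS ffnatD IH mulnS.
Qed.

Definition inc a l : Nd := [ffun k => (a k + (k == l))%N].
Definition incs a J : Nd := [ffun k => (a k + (k \in J))%N].

(** For the value semigroup of a ring R, this says that raising coordinate [l] of [a] strictly
    shrinks the ideal R(a). *)
Definition jump S a l : Prop := exists s, [/\ S s, cw_le a s & s l = a l].

Lemma cw_le_refl a : cw_le a a. Proof. by move=> l. Qed.
Lemma cw_le_trans b a s : cw_le a b -> cw_le b s -> cw_le a s.
Proof. by move=> ab bs l; apply: leq_trans (ab l) (bs l). Qed.

Lemma inc_ge a l : cw_le a (inc a l).
Proof. by move=> k; rewrite ffunE leq_addr. Qed.

Lemma incs_ge a J : cw_le a (incs a J).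
Proof. by move=> k; rewrite ffunE leq_addr. Qed.

Lemma incs1 a l : incs a [set l]%SET = inc a l.
Proof. by apply/ffunP => k; rewrite !ffunE inE. Qed.

Lemma incsU1 a J l : l \notin J -> incs a (l |: J)%SET = inc (incs a J) l.
Proof.
by move=> lJ; apply/ffunP => k; rewrite !ffunE !inE; case: eqP => [->|_] //=;
  rewrite ?(negbTE lJ) ?addn0.
Qed.

Lemma path_ind b (P : Nd -> Prop) : P b ->
  (forall a l, cw_le a b -> (a l < b l)%N -> P (inc a l) -> P a) ->
  forall a, cw_le a b -> P a.
Proof.
move=> Pb step a; have [n] := ubnP (\sum_l (b l - a l)).
elim: n a => // n IH a ltn ab.
case: (pselect (exists l, (a l < b l)%N)) => [[l lt_l]|nl]; last first.
  suff -> : a = b by [].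
  apply/ffunP => l; apply/eqP; rewrite eqn_leq (ab l) /= leqNgt.
  by apply/negP => lt_l; apply: nl; exists l.
apply: (step a l) => //; apply: IH; last first.
  by move=> k; rewrite ffunE; case: eqP => [->|_]; rewrite ?addn1 ?addn0.
move: ltn; rewrite ltnS; apply: leq_trans.
rewrite (bigD1 l) //= [X in (_ < X)%N](bigD1 l) //= -addSn leq_add //.
  by rewrite ffunE eqxx addn1 subnSK.
by apply: leq_sum => k /negbTE kl; rewrite ffunE kl addn0.
Qed.

Definition meet_closed X := forall a b, X a -> X b -> X (cw_min a b).

(** The minimum of the witnesses for the coordinates outside [G] works. The first premise starts it,
    since there may be no such coordinate. *)
Lemma meet_exact X a G : meet_closed X ->
  (exists s, [/\ X s, cw_le a s & forall k, k \in G -> (a k < s k)%N]) ->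
  (forall l, l \notin G -> exists s,
    [/\ X s, cw_le a s, forall k, k \in G -> (a k < s k)%N & s l = a l]) ->
  exists s, [/\ X s, cw_le a s, forall k, k \in G -> (a k < s k)%N &
                forall l, l \notin G -> s l = a l].
Proof.
move=> Xm [s0 [Xs0 as0 Gs0]] ex.
suff /(_ (enum 'I_d)) [s [Xs as_ Gs es]] : forall r : seq 'I_d, exists s,
    [/\ X s, cw_le a s, forall k, k \in G -> (a k < s k)%N &
        forall l, l \in r -> l \notin G -> s l = a l].
  by exists s; split=> // l; apply: es; rewrite mem_enum.
elim=> [|l r [s [Xs as_ Gs es]]]; first by exists s0; split.
have [lG|lG] := boolP (l \in G).
  exists s; split=> // k; rewrite inE => /orP[/eqP->|]; first by rewrite lG.
  exact: es.
have [u [Xu au Gu eu]] := ex l lG.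
exists (cw_min s u); split=> [|k|k kG|k].
- exact: Xm.
- by rewrite ffunE leq_min as_ au.
- by rewrite ffunE leq_min Gs ?Gu.
rewrite inE ffunE => /orP[/eqP-> _|kr kG].
  by rewrite eu; apply/minn_idPr; apply: as_.
by rewrite es //; apply/minn_idPl; apply: au.
Qed.

End Jumps.

(** * Levels from an abstract function [lam] obeying the jump rule *)

Section LevelFunction.
Variable d : nat.
Local Notation Nd := {ffun 'I_d -> nat}.
Variables (S E : set Nd) (lam : Nd -> nat) (N : nat).
Hypothesis d_gt0 : (0 < d)%N.
Hypothesis S_meet : meet_closed S.
Hypothesis E_meet : meet_closed E.
Hypothesis S_exchange : forall a g k l, S a -> S g -> cw_le a g ->
  g l = a l -> (a k < g k)%N ->
  exists h, [/\ S h, cw_le a h, (a l < h l)%N & h k = a k].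
Hypothesis lam_jump : forall a l, jump S a l -> ~ jump E a l ->
  lam (inc a l) = (lam a).+1.
Hypothesis lam_nojumpS : forall a l, ~ jump S a l -> lam (inc a l) = lam a.
Hypothesis lam_nojumpE : forall a l, jump E a l -> lam (inc a l) = lam a.
Hypothesis lam_cap : exists c, forall a, cw_le c a -> lam a = N.
Implicit Types (a b s : Nd).

Local Notation A := (S `\` E).

Lemma lam_inc_bounds a l : (lam a <= lam (inc a l) <= (lam a).+1)%N.
Proof.
case: (pselect (jump S a l)) => jS; last by rewrite lam_nojumpS ?leqnn ?leqnSn.
case: (pselect (jump E a l)) => jE; first by rewrite lam_nojumpE ?leqnn ?leqnSn.
by rewrite lam_jump ?leqnSn ?leqnn.
Qed.

Lemma lam_mono a b : cw_le a b -> (lam a <= lam b)%N.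
Proof.
move: a; apply: path_ind => // a l _ _; apply: leq_trans.
by case/andP: (lam_inc_bounds a l).
Qed.

Lemma lam_leN a : (lam a <= N)%N.
Proof.
have [c cN] := lam_cap.
pose b : Nd := [ffun l => maxn (a l) (c l)].
by rewrite -(cN b) => [|l]; [apply: lam_mono => l|]; rewrite ffunE ?leq_maxl ?leq_maxr.
Qed.

Lemma A_of_nojumpE a s l : S s -> cw_le a s -> s l = a l -> ~ jump E a l -> A s.
Proof. by move=> Ss as_ sl nE; split=> // Es; apply: nE; exists s. Qed.

(** Otherwise the minimum of witnesses in E for all coordinates would be [a] itself. *)
Lemma A_nojumpE a : A a -> exists l, ~ jump E a l.
Proof.
case=> Sa nEa; apply: contrapT => nl.
have jE l : jump E a l by apply: contrapT => nj; apply: nl; exists l.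
have [] := @meet_exact _ E a finset.set0 E_meet.
- by have [s [Es as_ _]] := jE (Ordinal d_gt0); exists s; split=> // k; rewrite inE.
- by move=> l _; have [s [Es as_ sl]] := jE l; exists s; split=> // k; rewrite inE.
move=> s [Es _ _ sl]; apply: nEa; suff -> : a = s by [].
by apply/ffunP => l; rewrite sl ?inE.
Qed.

(** Walk from [a] towards [b]. At a coordinate that jumps in S but not in E, the minimum of [b] with
    a witness stays in A and replaces [b]. Any other coordinate of [a] is raised without changing
    [lam]. *)
Lemma A_descend a b : A b -> cw_le a b ->
  exists s, [/\ A s, cw_le a s, cw_le s b & lam s = lam a].
Proof.
have [n] := ubnP (\sum_l (b l - a l)); elim: n a b => // n IH a b ltn Ab ab.
case: (pselect (exists l, (a l < b l)%N)) => [[l lt_l]|nl]; last first.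
  suff -> : a = b by exists b; split=> //; apply: cw_le_refl.
  apply/ffunP => l; apply/eqP; rewrite eqn_leq (ab l) /= leqNgt.
  by apply/negP => lt_l; apply: nl; exists l.
have [[jS nE]|nj] := pselect (jump S a l /\ ~ jump E a l).
  have [s [Ss as_ sl]] := jS.
  have ml : cw_min b s l = a l by rewrite ffunE sl; apply/minn_idPr/ab.
  have am : cw_le a (cw_min b s) by move=> k; rewrite ffunE leq_min ab as_.
  have mb : cw_le (cw_min b s) b by move=> k; rewrite ffunE geq_minl.
  have [] := IH a (cw_min b s) _ _ am.
  - move: ltn; rewrite ltnS; apply: leq_trans.
    rewrite (bigD1 l) //= [X in (_ < X)%N](bigD1 l) //= -addSn leq_add //.
      by rewrite ml subnn subn_gt0.
    by apply: leq_sum => k _; rewrite leq_sub2r.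
  - by apply: (A_of_nojumpE _ am ml nE); apply: S_meet => //; case: Ab.
  by move=> u [Au au um lu]; exists u; split=> //; apply: cw_le_trans mb.
have lamE : lam (inc a l) = lam a.
  case: (pselect (jump S a l)) => jS; last exact: lam_nojumpS.
  by apply: lam_nojumpE; apply: contrapT => nE; apply: nj.
have [||u [Au au ub lu]] := IH (inc a l) b _ Ab.
- move: ltn; rewrite ltnS; apply: leq_trans.
  rewrite (bigD1 l) //= [X in (_ < X)%N](bigD1 l) //= -addSn leq_add //.
    by rewrite ffunE eqxx addn1 subnSK.
  by apply: leq_sum => k /negbTE kl; rewrite ffunE kl addn0.
- by move=> k; rewrite ffunE; case: eqP => [->|_]; rewrite ?addn1 ?addn0.
exists u; split; rewrite ?lu //.
by apply: cw_le_trans au; apply: inc_ge.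
Qed.

(** On a path from [a] to a point where [lam] is N, [lam] grows at some step, and the witness of
    that jump lies in A. *)
Lemma A_above a : (lam a < N)%N -> exists b, A b /\ cw_le a b.
Proof.
have [c cN] := lam_cap.
have [b ab lb] : exists2 b, cw_le a b & lam b = N.
  exists [ffun l => maxn (a l) (c l)]; first by move=> l; rewrite ffunE leq_maxl.
  by apply: cN => l; rewrite ffunE leq_maxr.
move: a ab; apply: path_ind => [|a l _ _ IH lta]; first by rewrite lb ltnn.
case: (pselect (jump S a l /\ ~ jump E a l)) => [[[s [Ss as_ sl]] nE]|nj].
  by exists s; split=> //; apply: A_of_nojumpE nE.
have lamE : lam (inc a l) = lam a.
  case: (pselect (jump S a l)) => jS; last exact: lam_nojumpS.
  by apply: lam_nojumpE; apply: contrapT => nE; apply: nj.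
have [|u [Au au]] := IH; first by rewrite lamE.
by exists u; split=> //; apply: cw_le_trans au; apply: inc_ge.
Qed.

Lemma lam_lt a b : A a -> (forall l, a l < b l)%N -> (lam a < lam b)%N.
Proof.
move=> Aa ab; have [l nE] := A_nojumpE Aa.
have jS : jump S a l by case: Aa => Sa _; exists a; split=> //; apply: cw_le_refl.
rewrite -(lam_jump jS nE); apply: lam_mono => k; rewrite ffunE.
by case: eqP => [->|_]; rewrite ?addn1 ?addn0 // ltnW.
Qed.

Lemma lamA_ltN a : A a -> (lam a < N)%N.
Proof.
move=> Aa; apply: leq_trans (lam_leN [ffun l => (a l).+1]).
by apply: lam_lt => // l; rewrite ffunE.
Qed.

Section BelowLevel.
Variables (a : Nd) (l0 : 'I_d).
Hypothesis Sa : S a.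
Hypothesis nE0 : ~ jump E a l0.

(** The coordinates forced up together with [l] by elements of S above [a]. Exchange makes this an
    equivalence relation. *)
Definition tied (l : 'I_d) : {set 'I_d} :=
  [set k | `[< forall s, S s -> cw_le a s -> (a l < s l)%N -> (a k < s k)%N >]]%SET.

Lemma tiedP l k : reflect (forall s, S s -> cw_le a s -> (a l < s l)%N -> (a k < s k)%N)
  (k \in tied l).
Proof. by rewrite inE; apply: (iffP (asboolP _)). Qed.

Lemma tied_refl l : l \in tied l.
Proof. exact/tiedP. Qed.

Lemma tied_sym l k : k \in tied l -> l \in tied k.
Proof.
move=> /tiedP kl; apply/tiedP => s Ss as_ sk; rewrite ltnNge; apply/negP => sl.
have {}sl : s l = a l by apply/eqP; rewrite eqn_leq sl; apply: as_.
have [h [Sh ah hl hk]] := S_exchange Sa Ss as_ sl sk.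
by have := kl h Sh ah hl; rewrite hk ltnn.
Qed.

Lemma tied_trans l k j : k \in tied l -> j \in tied k -> j \in tied l.
Proof. by move=> /tiedP kl /tiedP jk; apply/tiedP => s Ss as_ /(kl _ Ss as_); apply: jk. Qed.

Lemma tied_eq l k : k \in tied l -> tied k = tied l.
Proof.
move=> kl; apply/setP => j; apply/idP/idP; first exact: tied_trans.
exact/tied_trans/tied_sym.
Qed.

Lemma tied_not_jump l k b : k \in tied l -> cw_le a b -> (a l < b l)%N ->
  b k = a k -> ~ jump S b k.
Proof.
move=> /tiedP kl ab bl bk [s [Ss bs sk]].
have := kl s Ss (cw_le_trans ab bs) (leq_trans bl (bs l)).
by rewrite sk bk ltnn.
Qed.

(** Raising [l] costs at most one level; the coordinates tied to it are then no jumps and rise for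
    free. *)
Lemma lam_tied l : (lam (incs a (tied l)) <= (lam a).+1)%N.
Proof.
have /andP[_ le1] := lam_inc_bounds a l; apply: leq_trans le1.
have lel : cw_le (inc a l) (incs a (tied l)).
  move=> k; rewrite !ffunE leq_add2l; case: eqP => // ->.
  by rewrite tied_refl.
suff H b : cw_le b (incs a (tied l)) -> cw_le (inc a l) b ->
    (lam (incs a (tied l)) <= lam b)%N by apply: H => //; apply: cw_le_refl.
move: b; apply: path_ind => [//|b k _ ltk IH ab].
suff <- : lam (inc b k) = lam b by apply/IH/(cw_le_trans ab)/inc_ge.
have aab := cw_le_trans (inc_ge a l) ab.
apply: lam_nojumpS; apply: (@tied_not_jump l) => //.
- by move: ltk; rewrite ffunE; case: (k \in tied l) => //; rewrite addn0 ltnNge aab.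
- by have := ab l; rewrite ffunE eqxx addn1.
apply/eqP; rewrite eqn_leq aab andbT -ltnS.
by move: ltk; rewrite ffunE; case: (k \in tied l); rewrite ?addn1 ?addn0 // ltnNge aab.
Qed.

(* A partition of the index set by the tied classes, except that one part is a
   maximal set [G] containing [l0] that can be raised at the cost of one level. *)
Lemma below_level_partition : ((lam a).+1 < lam (incs a [set: 'I_d]%SET))%N ->
  exists part : 'I_d -> {set 'I_d},
    [/\ forall l, l \in part l,
        forall l k, k \in part l -> part k = part l,
        forall l, part l != [set: 'I_d]%SET &
        forall l, exists b, [/\ A b, (lam b <= (lam a).+1)%N,
          forall k, k \in part l -> (a k < b k)%N &
          forall k, k \notin part l -> b k = a k]].
Proof.
move=> lt_lam; pose P J := (lam (incs a J) <= (lam a).+1)%N.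
have Pl0 : P [set l0]%SET by rewrite /P incs1; case/andP: (lam_inc_bounds a l0).
have [G /maxsetP[PG Gmax]] := maxset_exists Pl0; rewrite finset.sub1set => l0G.
have GT : G != [set: 'I_d]%SET by apply: contraTneq PG => ->; rewrite /P -ltnNge.
have Gout l : l \notin G -> ~ P (l |: G)%SET.
  move=> lG PlG; move: lG; rewrite -(Gmax _ PlG) ?finset.subsetUr //.
  by rewrite finset.setU11.
(* If the class of [l] met [G], then once [G] is raised [l] would be no jump, and [G] could be
   enlarged by [l]. *)
have disj l k : l \notin G -> k \in tied l -> k \notin G.
  move=> lG kl; apply/negP => kG; apply: (Gout l lG).
  rewrite /P incsU1 // lam_nojumpS //; apply: (@tied_not_jump k) (tied_sym kl) _ _ _.
  - exact: incs_ge.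
  - by rewrite ffunE kG addn1.
  by rewrite ffunE (negbTE lG) addn0.
have ltN : (lam (incs a G) < N)%N.
  by apply: leq_ltn_trans PG (leq_trans lt_lam (lam_leN _)).
have [b0 [Ab0 ab0]] := A_above ltN.
have [g [Ag ag gb lamg]] := A_descend Ab0 ab0.
(* A coordinate outside [G] raised by [g] could be added to [G] at no cost, against maximality. *)
have g_out k : k \notin G -> g k = a k.
  move=> kG; apply/eqP; rewrite eqn_leq [X in _ && X](cw_le_trans (@incs_ge _ a G) ag) andbT.
  rewrite leqNgt; apply/negP => ltk; apply: (Gout k kG).
  rewrite /P; apply: leq_trans PG; rewrite -lamg; apply: lam_mono => j.
  rewrite ffunE !inE; case: eqP => [->|_] /=; first by rewrite addn1.
  by have := ag j; rewrite ffunE.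
pose part l := if l \in G then G else tied l.
exists part; split=> [l|l k|l|l]; rewrite /part.
- by case: ifP => // _; apply: tied_refl.
- case: ifPn => [_ ->//|lG kl].
  by rewrite (negbTE (disj _ _ lG kl)); apply: tied_eq.
- case: ifPn => // lG; apply/eqP => eT.
  by have := disj l l0 lG; rewrite eT inE l0G => /(_ isT).
case: ifPn => lG.
  exists g; split=> // [|k kG]; first by rewrite lamg.
  by have := ag k; rewrite ffunE kG addn1.
have l0l : l0 \notin tied l by apply/negP => /(disj _ _ lG); rewrite l0G.
have away k : k \notin tied l -> exists s, [/\ S s, cw_le a s,
    forall j, j \in tied l -> (a j < s j)%N & s k = a k].
  move=> /tiedP; apply: contra_notP => nex s Ss as_ sl; rewrite ltnNge.
  apply/negP => sk; apply: nex; exists s; split=> // [j /tiedP|]; first exact.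
  by apply/eqP; rewrite eqn_leq sk; apply: as_.
have [|s [Ss as_ sgt sle]] := meet_exact S_meet _ away.
  by have [s [Ss as_ sgt _]] := away _ l0l; exists s.
(* [s] agrees with [a] at [l0], where E has no jump. *)
have As : A s by apply: (A_of_nojumpE Ss as_ (sle _ l0l)).
have incs_le : cw_le (incs a (tied l)) s.
  move=> k; rewrite ffunE; have [/sgt|_] := boolP (k \in tied l); first by rewrite addn1.
  by rewrite addn0; apply: as_.
have [b [Ab ab bs lamb]] := A_descend As incs_le.
exists b; split=> // [|k kl|k kl]; first by rewrite lamb lam_tied.
  by have := ab k; rewrite ffunE kl addn1.
apply/eqP; rewrite eqn_leq [X in _ && X](cw_le_trans (@incs_ge _ a _) ab) andbT.
by rewrite -(sle k kl); apply: bs.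
Qed.

End BelowLevel.

(** The sets F_j are the complements of the parts of the partition: disjoint parts make [a] the
    pairwise minimum, and since the parts cover all indices the F_j have empty intersection. *)
Lemma below_level_complete_infimum a : A a -> ((lam a).+1 < lam (incs a [set: 'I_d]%SET))%N ->
  exists (r : nat) (b : 'I_r -> Nd),
    [/\ (1 < r <= d)%N, forall j, A (b j) /\ cw_le a (b j),
        forall j, (lam (b j) <= (lam a).+1)%N & complete_infimum S a b].
Proof.
move=> Aa lt_lam; have [l0 nE0] := A_nojumpE Aa.
have [part [part_refl part_eq partT ex]] := below_level_partition Aa.1 nE0 lt_lam.
pose Ps := [set part l | l : 'I_d]%SET.
have memP (j : 'I_#|Ps|) : {l | enum_val j = part l}.
  by have /imsetP/cid2[l _ ->] := enum_valP j; exists l.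
have /choice[b bP] (j : 'I_#|Ps|) : exists b : Nd,
    [/\ A b, (lam b <= (lam a).+1)%N,
       forall k, k \in enum_val j -> (a k < b k)%N &
       forall k, k \notin enum_val j -> b k = a k].
  by have [l ->] := memP j; apply: ex.
have ab j : cw_le a (b j).
  move=> k; have [_ _ gt eq] := bP j.
  by have [/gt/ltnW|/eq->] := boolP (k \in enum_val j).
have disj (j j' : 'I_#|Ps|) k : j != j' -> k \in enum_val j -> k \notin enum_val j'.
  move=> jj' kj; apply: contra jj' => kj'; have [l el] := memP j.
  have [l' el'] := memP j'; move: kj kj'; rewrite el el' => kj kj'; apply/eqP/enum_val_inj.
  by rewrite el el' -(part_eq _ _ kj) (part_eq _ _ kj').
exists #|Ps|, b; split=> [|j|j|].
- apply/andP; split; last by rewrite -[leqRHS]card_ord leq_imset_card.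
  have [l ll0] : exists l, l \notin part l0.
    by apply/existsP; rewrite -negb_forall; apply: contra (partT l0) => /forallP al;
      apply/eqP/setP => l; rewrite al inE.
  apply/card_gt1P; exists (part l0), (part l); rewrite !finset.imset_f //; split=> //.
  by apply: contraNneq ll0 => ->.
- by split; [case: (bP j)|].
- by case: (bP j).
exists (fun j => ~: enum_val j)%SET; split=> [j|j|j j' jj'|].
- have [l el] := memP j; rewrite el; split.
    by apply: contra (partT l) => /eqP e0; rewrite -[part l]finset.setCK e0 finset.setC0.
  rewrite properT; apply/eqP => eT.
  by have := finset.in_setT l; rewrite -eT inE part_refl.
- have [[Sb _] _ gt eq] := bP j; split=> // k; rewrite inE; first exact: eq.
  by rewrite negbK; apply: gt.
- apply/ffunP => k; rewrite ffunE; have [_ _ _ eq] := bP j.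
  have [_ _ _ eq'] := bP j'; have [kj|kj] := boolP (k \in enum_val j).
    by rewrite (eq' k (disj _ _ _ jj' kj)); apply/esym/minn_idPr/ab.
  by rewrite (eq k kj); apply/esym/minn_idPl/ab.
apply/setP => l; rewrite inE; apply/negP => /bigcapP al.
have lP : part l \in Ps by apply: finset.imset_f.
by have := al (enum_rank_in lP (part l)) isT; rewrite inE enum_rankK_in ?part_refl.
Qed.

Let P i : set Nd := [set a | A a /\ (lam a <= i)%N].

Lemma Bpart_level i a : A a -> lam a = i -> Bpart (P i) a.
Proof.
move=> Aa lai; split; first by split; rewrite ?lai.
move=> b [Ab lbi] [//|ab]; have := lam_lt Aa ab.
by rewrite lai ltnNge lbi.
Qed.

Lemma Dpart_level i : (i < N)%N -> Dpart S (P i) = [set a | A a /\ lam a = i].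
Proof.
move=> iN; apply/seteqP; split=> [a [[[Aa lai] amax] nC]|a [Aa lai]]; last first.
  split; first exact: Bpart_level.
  move=> [_ [r [b [/andP[r1 _] bB [F [Fp Fd Fmin F0]]]]]].
  have [l nE] := A_nojumpE Aa.
  (* As the F_j have no common index, some [b j] exceeds [a] at the coordinate [l], where this costs
     a level. *)
  have [j ljF] : exists j, l \notin F j.
    apply/existsP; rewrite -negb_forall; apply/negP => /forallP al.
    by have := finset.in_set0 l; rewrite -F0; move/negP; apply; apply/bigcapP.
  have [[[Sb nEb] lbi] _] := bB j; have [_ Feq Fgt] := Fd j.
  have jS : jump S a l by case: Aa => Sa _; exists a; split=> //; apply: cw_le_refl.
  have : cw_le (inc a l) (b j).
    move=> k; rewrite ffunE; case: eqP => [->|_]; first by rewrite addn1 Fgt.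
    by rewrite addn0; have [/Feq->|/Fgt/ltnW] := boolP (k \in F j).
  by move=> /lam_mono; rewrite (lam_jump jS nE) lai => /leq_trans/(_ lbi); rewrite ltnn.
split=> //; move: lai; rewrite leq_eqVlt => /orP[/eqP//|lti]; case: nC.
(* Whatever strictly dominates such a [b] strictly dominates [a], against the maximality of [a]. *)
have maxP b : A b -> cw_le a b -> (lam b <= i)%N -> Bpart (P i) b.
  move=> Ab ab lb; split=> // s [As lsi] [//|bs].
  have as_ : lele a s by right=> l; apply: leq_ltn_trans (ab l) (bs l).
  have sa := amax _ (conj As lsi) as_.
  by have := bs (Ordinal d_gt0); rewrite sa ltnNge ab.
split; first exact: maxP (cw_le_refl a) (ltnW lti).
(* If raising all coordinates costs at most one level, some element of A strictly above [a] has
   [lam] at most [i], against maximality; otherwise [a] is a complete infimum. *)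
have [le1|lt1] := leqP (lam (incs a [set: 'I_d]%SET)) (lam a).+1; last first.
  have [r [b [rd Ab lb ib]]] := below_level_complete_infimum Aa lt1.
  exists r, b; split=> // j; have [Abj abj] := Ab j.
  by apply: maxP => //; apply: leq_trans (lb j) lti.
have [|u [Au au]] := @A_above (incs a [set: 'I_d]%SET).
  by apply: leq_ltn_trans le1 (leq_ltn_trans lti iN).
have [s [As as_ _ ls]] := A_descend Au au.
have lt_as l : (a l < s l)%N by have := as_ l; rewrite ffunE inE addn1.
have sa : s = a.
  apply: amax; last by right.
  by split=> //; rewrite ls; apply: leq_trans le1 lti.
by have := lt_as (Ordinal d_gt0); rewrite sa ltnn.
Qed.

(** Levels are peeled off from the top: D^(j) consists of the elements with [lam] equal to N - j. *)
Lemma level_lam omega : E = [set omega + s | s in S] -> (\sum_(k < d) omega k)%N = N ->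
  forall i, (i < N)%N -> level S omega i = [set a | A a /\ lam a = i].
Proof.
move=> Ew sumN.
have rest j : (j < N)%N -> Dunion S omega j = [set a | A a /\ (N - j <= lam a)%N] ->
    apery S omega `\` Dunion S omega j = P (N - j.+1)%N.
  move=> jN ->; rewrite /apery -Ew; apply/seteqP; split=> a [Aa].
    move=> nl; split=> //; rewrite leqNgt; apply/negP => lt; apply: nl; split=> //.
    by move: lt; lia.
  by move=> le; split=> // -[_]; move: le; lia.
have D j : (j <= N)%N -> Dunion S omega j = [set a | A a /\ (N - j <= lam a)%N].
  elim: j => [_|j IH jN] /=.
    by apply/seteqP; split=> // a [/lamA_ltN]; rewrite subn0 ltnNge => /negbTE->.
  rewrite (rest _ jN (IH (ltnW jN))) Dpart_level ?(IH (ltnW jN)); last by lia.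
  apply/seteqP; split=> [a [[Aa la]|[Aa la]]|a [Aa la]].
  - by split=> //; lia.
  - by split=> //; lia.
  have [lt|ge] := ltnP (lam a) (N - j); [right|left]; split=> //; lia.
move=> i iN; rewrite /level /Dset sumN.
have jN : ((N - i).-1 < N)%N by lia.
have jE : (N - (N - i).-1.+1 = i)%N by lia.
by rewrite (rest _ jN (D _ (ltnW jN))) Dpart_level jE.
Qed.

End LevelFunction.

(** * Power series *)

Section FpsTheory.
Variable R : comNzRingType.
Implicit Types (f g a s : fps R) (k n : nat).

Lemma fcoefD f g k : fcoef (f + g) k = fcoef f k + fcoef g k. Proof. by []. Qed.
Lemma fcoefN f k : fcoef (- f) k = - fcoef f k. Proof. by []. Qed.
Lemma fcoefB f g k : fcoef (f - g) k = fcoef f k - fcoef g k. Proof. by []. Qed.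
Lemma fcoefM f g k : fcoef (f * g) k = \sum_(i < k.+1) fcoef f i * fcoef g (k - i).
Proof. by []. Qed.
Lemma fcoef0 k : fcoef (0 : fps R) k = 0. Proof. by []. Qed.
Lemma fcoef1 k : fcoef (1 : fps R) k = (k == 0)%:R. Proof. by rewrite /=; case: eqP. Qed.

Lemma fcoefCM c f k : fcoef (fpsC c * f) k = c * fcoef f k.
Proof.
rewrite fcoefM big_ord_recl /= subn0 big1 ?addr0 // => i _.
by rewrite mul0r.
Qed.

Lemma fcoefM_0 f g : fcoef (f * g) 0 = fcoef f 0 * fcoef g 0.
Proof. by rewrite fcoefM big_ord1. Qed.

Fact fpsC_zmod : zmod_morphism (@fpsC R).
Proof. by move=> a b; apply: fpsP => -[|n] //=; rewrite subr0. Qed.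
Fact fpsC_monoid : monoid_morphism (@fpsC R).
Proof. by split=> // a b; apply: fpsP => -[|n]; rewrite fcoefCM //= mulr0. Qed.
HB.instance Definition _ := GRing.isZmodMorphism.Build R (fps R) (@fpsC R) fpsC_zmod.
HB.instance Definition _ := GRing.isMonoidMorphism.Build R (fps R) (@fpsC R) fpsC_monoid.

Definition fconst f : R := fcoef f 0.
Fact fconst_zmod : zmod_morphism fconst. Proof. by []. Qed.
Fact fconst_monoid : monoid_morphism fconst.
Proof. by split=> // f g; rewrite /fconst fcoefM_0. Qed.
HB.instance Definition _ := GRing.isZmodMorphism.Build (fps R) R fconst fconst_zmod.
HB.instance Definition _ := GRing.isMonoidMorphism.Build (fps R) R fconst fconst_monoid.

Definition fpsX : fps R := Fps (fun n => (n == 1)%:R).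
Definition fshift f : fps R := Fps (fun n => fcoef f n.+1).

Lemma fcoefXM f k : fcoef (fpsX * f) k = if k is k'.+1 then fcoef f k' else 0.
Proof.
case: k => [|k]; first by rewrite fcoefM_0 mul0r.
rewrite fcoefM !big_ord_recl /= mul0r add0r mul1r subSS subn0 big1 ?addr0 // => i _.
by rewrite mul0r.
Qed.

Lemma fshiftE f : f = fpsC (fconst f) + fpsX * fshift f.
Proof. by apply: fpsP => -[|k]; rewrite fcoefD fcoefXM /= ?addr0 ?add0r. Qed.

(* The order of [f] is at least [k], the order of 0 being infinite. *)
Definition vge f k := forall i, (i < k)%N -> fcoef f i = 0.

Lemma vge_0 f : vge f 0. Proof. by []. Qed.
Lemma vgeD f g k : vge f k -> vge g k -> vge (f + g) k.
Proof. by move=> fk gk i ik; rewrite fcoefD fk ?gk ?addr0. Qed.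
Lemma vgeN f k : vge f k -> vge (- f) k.
Proof. by move=> fk i ik; rewrite fcoefN fk ?oppr0. Qed.
Lemma vgeB f g k : vge f k -> vge g k -> vge (f - g) k.
Proof. by move=> fk gk; apply/vgeD/vgeN. Qed.
Lemma vgeW f k n : (k <= n)%N -> vge f n -> vge f k.
Proof. by move=> kn fn i ik; apply/fn/(leq_trans ik). Qed.
Lemma vgeM f g k n : vge f k -> vge g n -> vge (f * g) (k + n).
Proof.
move=> fk gn i ilt; rewrite fcoefM big1 // => j _.
have [/fk->|kj] := ltnP j k; first by rewrite mul0r.
rewrite gn ?mulr0 //; move: (ltn_ord j) => {}jlt; lia.
Qed.
Lemma vgeMl f g k : vge g k -> vge (f * g) k.
Proof. exact: (@vgeM f g 0). Qed.
Lemma vgeX f k n : vge f k -> vge (f ^+ n) (k * n).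
Proof.
move=> fk; elim: n => [|n IH]; first by rewrite muln0.
by rewrite exprS mulnS; apply: vgeM.
Qed.
Lemma vge_all f : (forall k, vge f k) -> f = 0.
Proof. by move=> al; apply: fpsP => k; apply: (al k.+1). Qed.
Lemma vgeS f k : vge f k -> fcoef f k = 0 -> vge f k.+1.
Proof. by move=> fk fk0 i; rewrite ltnS leq_eqVlt => /orP[/eqP->|/fk]. Qed.
Lemma vge1 f : fcoef f 0 = 0 -> vge f 1. Proof. by move=> f0 [|]. Qed.

Lemma fcoefM_vge f g k n : vge f k -> vge g n ->
  fcoef (f * g) (k + n) = fcoef f k * fcoef g n.
Proof.
move=> fk gn; have lk : (k < (k + n).+1)%N by rewrite ltnS leq_addr.
rewrite fcoefM (bigD1 (Ordinal lk)) //= addKn big1 ?addr0 // => i.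
rewrite -val_eqE /= neq_ltn => /orP[/fk->|ki]; first by rewrite mul0r.
rewrite gn ?mulr0 //; move: (ltn_ord i) => {}ilt; lia.
Qed.

Lemma vge_divX f k : vge f k -> exists g, f = fpsX ^+ k * g.
Proof.
elim: k f => [|k IH] f fk; first by exists f; rewrite mul1r.
have [|g gE] := IH (fshift f); first by move=> i ik; apply: fk.
by exists g; rewrite (fshiftE f) /fconst fk // rmorph0 add0r {1}gE exprS mulrA.
Qed.

(** Iterating the identity k times shows that [D s] has order at least k. Uniqueness and
    multiplicativity of substitution follow from this. *)
Lemma vge_contract a s (D : fps R -> fps R) : vge a 1 ->
  (forall s, D s = a * D (fshift s)) -> D s = 0.
Proof.
move=> a1 DE; apply: vge_all => k; elim: k s => // k IH s.
by rewrite DE -add1n; apply: vgeM.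
Qed.

(** * Substitution of a series of positive order *)

Section Substitution.
Variable a : fps R.
Hypothesis a1 : vge a 1.

Definition subst_raw s : fps R :=
  Fps (fun k => \sum_(n < k.+1) fcoef s n * fcoef (a ^+ n) k).

(* The composite series [s(a)]; the order hypothesis on [a] makes each
   coefficient a finite sum. *)
Definition subst of vge a 1 := subst_raw.
Local Notation sub := (subst a1).

Lemma coef_subst s k m : (k <= m)%N ->
  fcoef (sub s) k = \sum_(n < m.+1) fcoef s n * fcoef (a ^+ n) k.
Proof.
move=> km; rewrite /= (big_ord_widen m.+1 (fun n => fcoef s n * fcoef (a ^+ n) k)) ?ltnS //.
rewrite big_mkcond; apply: eq_bigr => n _; case: ifPn => //.
by rewrite -leqNgt => kn; rewrite (vgeX a1) ?mulr0 // mul1n.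
Qed.

Lemma substS s : sub s = fpsC (fconst s) + a * sub (fshift s).
Proof.
apply: fpsP => k; rewrite fcoefD fcoefM.
under eq_bigr => i _ do rewrite (@coef_subst _ (k - i) k (leq_subr _ _)) mulr_sumr.
rewrite exchange_big.
have e n : \sum_(i < k.+1) fcoef a i * (fcoef (fshift s) n * fcoef (a ^+ n) (k - i)) =
    fcoef s n.+1 * fcoef (a ^+ n.+1) k.
  by rewrite exprS fcoefM mulr_sumr; apply: eq_bigr => i _; rewrite mulrCA.
rewrite (eq_bigr _ (fun (n : 'I_k.+1) _ => e n)).
rewrite -[X in X = _]/(fcoef (sub s) k) (@coef_subst _ k k.+1) // big_ord_recl expr0.
by congr (_ + _); rewrite /= /fconst; case: ifP; rewrite ?mulr1 ?mulr0.
Qed.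

Fact subst_zmod : zmod_morphism sub.
Proof.
move=> s t; apply: fpsP => k; rewrite fcoefB /= -sumrB.
by apply: eq_bigr => n _; rewrite mulrBl.
Qed.
HB.instance Definition _ := GRing.isZmodMorphism.Build (fps R) (fps R) sub subst_zmod.

Lemma substC c : sub (fpsC c) = fpsC c.
Proof.
rewrite substS; have -> : fshift (fpsC c) = 0 by apply: fpsP.
by rewrite raddf0 mulr0 addr0.
Qed.

Lemma substXM s : sub (fpsX * s) = a * sub s.
Proof.
rewrite substS; have -> : fshift (fpsX * s) = s.
  by apply: fpsP => k; rewrite /= -[LHS]/(fcoef (fpsX * s) k.+1) fcoefXM.
by rewrite /fconst fcoefXM rmorph0 add0r.
Qed.

Lemma substCM c s : sub (fpsC c * s) = fpsC c * sub s.
Proof.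
apply: fpsP => k; rewrite fcoefCM /= mulr_sumr; apply: eq_bigr => n _.
by rewrite -[X in X * _]/(fcoef (fpsC c * s) n) fcoefCM mulrA.
Qed.

Fact subst_monoid : monoid_morphism sub.
Proof.
split=> [|s t]; first by rewrite -(rmorph1 (@fpsC R)) substC.
apply/eqP; rewrite -subr_eq0; apply/eqP.
apply: (vge_contract (D := fun s => sub (s * t) - sub s * sub t) s a1) => {}s.
rewrite {1 2}(fshiftE s) mulrDl -mulrA !raddfD /= substCM !substXM substC mulrDl.
by rewrite opprD addrACA subrr add0r mulrBr mulrA.
Qed.
HB.instance Definition _ := GRing.isMonoidMorphism.Build (fps R) (fps R) sub subst_monoid.

Lemma substX : sub fpsX = a.
Proof. by rewrite -[fpsX]mulr1 substXM rmorph1 mulr1. Qed.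

End Substitution.

Lemma subst_uniq a (a1 : vge a 1) (F : fps R -> fps R) :
  (forall s, F s = fpsC (fconst s) + a * F (fshift s)) -> forall s, F s = subst a1 s.
Proof.
move=> FE s; apply/eqP; rewrite -subr_eq0; apply/eqP.
apply: (vge_contract (D := fun s => F s - subst a1 s) s a1) => {}s.
by rewrite {1}FE substS opprD addrACA subrr add0r mulrBr.
Qed.

(** The inverse is the geometric series evaluated at [a]. *)
Lemma unit_fps1B a : vge a 1 -> exists g, g * (1 - a) = 1.
Proof.
move=> a1; exists (subst a1 (Fps (fun=> 1))); set J := Fps _.
have JE : subst a1 J = 1 + a * subst a1 J.
  by rewrite {1}substS; congr (_ + _ * subst a1 _); apply: fpsP.
by rewrite mulrBr mulr1 [_ * a]mulrC {1}JE addrK.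
Qed.

End FpsTheory.

Lemma unit_fps (R : comUnitRingType) (f : fps R) :
  fconst f \is a GRing.unit -> exists g, g * f = 1.
Proof.
move=> u0; have [|g gE] := @unit_fps1B _ (1 - fpsC (fconst f)^-1 * f).
  by apply: vge1; rewrite fcoefB fcoefCM mulVr // subrr.
exists (g * fpsC (fconst f)^-1).
by rewrite -mulrA -[_ * f](subKr 1).
Qed.

Section Orders.
Variable K : fieldType.
Implicit Types (f g a s q : fps K) (k n w : nat).

Lemma has_order_neq0 f k : has_order f k -> f != 0.
Proof. by move=> [fk _]; apply/eqP => f0; apply: fk; rewrite f0. Qed.

Lemma has_order_vge f k : has_order f k -> vge f k. Proof. by case. Qed.

Lemma vge_has_order f k n : vge f k -> has_order f n -> (k <= n)%N.
Proof. by move=> fk [fn _]; rewrite leqNgt; apply/negP => /fk. Qed.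

Lemma has_order_inj f k n : has_order f k -> has_order f n -> k = n.
Proof.
move=> fk fn; apply/eqP; rewrite eqn_leq.
by rewrite (vge_has_order (has_order_vge fk) fn) (vge_has_order (has_order_vge fn) fk).
Qed.

Lemma has_orderM f g k n : has_order f k -> has_order g n -> has_order (f * g) (k + n).
Proof.
move=> [fk fk0] [gn gn0]; split; last exact: vgeM.
by rewrite fcoefM_vge // => /eqP; rewrite mulf_eq0 => /orP[] /eqP.
Qed.

Lemma has_orderX f k n : has_order f k -> has_order (f ^+ n) (k * n).
Proof.
move=> fk; elim: n => [|n IH]; last by rewrite exprS mulnS; apply: has_orderM.
by rewrite muln0 expr0; split=> //; apply/eqP; rewrite fcoef1 oner_eq0.
Qed.

Lemma has_order_fpsX : has_order (fpsX K) 1.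
Proof. by split=> [|i]; [apply/eqP; rewrite /= oner_eq0|case: i]. Qed.

Lemma has_order_fpsXn k : has_order (fpsX K ^+ k) k.
Proof. by rewrite -[X in has_order _ X]mul1n; apply/has_orderX/has_order_fpsX. Qed.

Lemma fconst_unit f : fconst f != 0 -> f \is a GRing.unit.
Proof.
move=> f0; have [|g gE] := @unit_fps K f; first by rewrite unitfE.
by apply/unitrPr; exists g; rewrite mulrC.
Qed.

Lemma fps_div a s w k : has_order a w -> vge s (w + k) ->
  exists2 q, s = a * q & vge q k.
Proof.
move=> [aw /vge_divX[u aE]] /vge_divX[t sE]; subst a s.
have u0 : u \is a GRing.unit.
  apply/fconst_unit/eqP => u0; apply: aw.
  have /vgeM /(_ (vge1 u0)) : vge (fpsX K ^+ w) w by apply/has_order_vge/has_order_fpsXn.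
  by apply; rewrite addn1.
exists (fpsX K ^+ k * (t / u)).
  by rewrite exprD -!mulrA; congr (_ * _); rewrite [RHS]mulrCA [u * _]mulrC divrK.
by rewrite mulrC; apply/vgeMl/has_order_vge/has_order_fpsXn.
Qed.

Lemma vge_mulIl a q w k : has_order a w -> vge (a * q) (w + k) -> vge q k.
Proof.
by move=> aw /(fps_div aw)[q' /(mulfI (has_order_neq0 aw))->].
Qed.

Lemma has_order_mulIl a q w k : has_order a w -> has_order (a * q) (w + k) -> has_order q k.
Proof.
move=> aw [aqk aqv]; split; last exact: vge_mulIl aqv.
move=> qk; apply: aqk; rewrite fcoefM_vge ?qk ?mulr0 //; first by case: aw.
exact: vge_mulIl aqv.
Qed.

(** Each index excludes at most one scalar, - a i / b i. *)
Lemma avoid_scalar (infK : infinite_set [set: K]) (I : finType) (a b : I -> K) :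
  (forall i, a i <> 0 \/ b i <> 0) -> exists c, forall i, a i + c * b i <> 0.
Proof.
move=> ab; apply: contrapT => nex; apply: infK.
apply: (@sub_finite_set _ _ [set` [seq - (a i / b i) | i : I]]); last exact: finite_seq.
move=> c _ /=; apply: contrapT => cn; apply: nex; exists c => i aci; apply: cn.
have bi : b i != 0.
  apply/eqP => bi; case: (ab i) => //; apply.
  by move: aci; rewrite bi mulr0 addr0.
suff -> : c = - (a i / b i) by apply: fintype.image_f.
apply: (mulIf bi); rewrite mulNr divfK //.
by apply/eqP; rewrite -addr_eq0 addrC aci.
Qed.

End Orders.

(** * Monic polynomials over K[[x]] *)

Section PolyIdeals.
Variable K : fieldType.
Local Notation A := {poly fps K}.
Implicit Types (f g p q r : A) (I : A -> Prop).

Definition red p : {poly K} := map_poly (@fconst K) p.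

Definition constX : A := (fpsX K)%:P.

Lemma red_constX : red constX = 0.
Proof. by rewrite /red map_polyC /= /fconst /= polyC0. Qed.

Lemma red_eq0 p : red p = 0 -> exists p', p = constX * p'.
Proof.
move=> p0; exists (\poly_(i < size p) fshift p`_i); apply/polyP => i.
rewrite coefCM coef_poly; case: ltnP => [_|/leq_sizeP/(_ i (leqnn i))->]; last by rewrite mulr0.
rewrite {1}(fshiftE p`_i).
by rewrite -coef_map -/(red p) p0 coef0 rmorph0 add0r.
Qed.

Lemma red_monic f : f \is monic -> red f \is monic /\ size (red f) = size f.
Proof.
move=> fm; split; first exact: monic_map.
by apply: size_map_poly_id0; rewrite (monicP fm) rmorph1 oner_eq0.
Qed.

Record poly_ideal I : Prop := PolyIdeal {
  ideal_add : forall p q, I p -> I q -> I (p + q);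
  ideal_mulr : forall p q, I q -> I (p * q) }.

Lemma ideal_sub I p q : poly_ideal I -> I p -> I q -> I (p - q).
Proof. by move=> [ID IM] Ip Iq; rewrite -mulN1r; apply: ID => //; apply: IM. Qed.

Definition monic_deg I n := exists f, [/\ f \is monic, size f = n.+1 & I f].

Lemma monic_deg_up I m n : poly_ideal I -> (m <= n)%N -> monic_deg I m -> monic_deg I n.
Proof.
move=> [_ IM] mn [f [fm fs If]]; exists ('X^(n - m) * f); split; last exact: IM.
  by rewrite monicMl ?monicXn.
by rewrite size_monicM ?monicXn ?monic_neq0 // size_polyXn fs; lia.
Qed.

Lemma monic_division f p : f \is monic -> exists q r, p = q * f + r /\ (size r < size f)%N.
Proof.
move=> fm; exists (Pdiv.Ring.rdivp p f), (Pdiv.Ring.rmodp p f).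
by rewrite -Pdiv.RingMonic.rdivp_eq //; rewrite Pdiv.Ring.ltn_rmodp monic_neq0.
Qed.

(* A substitute for the Weierstrass preparation theorem: as long as the
   minimal monic degree exceeds the degree mod X, reducing a shift of [p] modulo
   the minimal monic yields a monic of smaller degree. *)
Lemma monic_deg_red I p : poly_ideal I -> (exists n, monic_deg I n) -> I p -> red p != 0 ->
  monic_deg I (size (red p)).-1.
Proof.
move=> Iid [n0 In0] Ip p0; set i := (size (red p)).-1.
have si : size (red p) = i.+1 by rewrite prednK // lt0n size_poly_eq0.
have ex : exists n, `[< monic_deg I n >] by exists n0; apply/asboolP.
have /asboolP Ij := ex_minnP ex; case: ex_minnP Ij => j /asboolP Ij jmin _.
have [ji|ij] := leqP j i; first exact: monic_deg_up Ij.
have [f [fm fs If]] := Ij; have [fbm fbs] := red_monic fm.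
(* The exponent brings the degree modulo x to j - 1, just below that of [f], so division by [f]
   leaves the reduction modulo x unchanged. *)
have [q [r [E sr]]] := monic_division ('X^(j.-1 - i) * p) fm.
have Ir : I r.
  have -> : r = 'X^(j.-1 - i) * p - q * f by rewrite E addrC addKr.
  by apply: ideal_sub => //; apply: (ideal_mulr Iid).
have rr : red r = 'X^(j.-1 - i) * red p.
  have := congr1 red E; rewrite /red !rmorphD !rmorphM /= map_polyXn => Er.
  rewrite -[RHS](@Pdiv.Ring.rmodp_small _ _ (red f)); last first.
    rewrite fbs fs size_monicM ?monicXn // size_polyXn si; lia.
  rewrite Er Pdiv.RingMonic.rmodp_addl_mul_small // fbs.
  by apply: leq_ltn_trans sr; apply: size_poly.
have srr : size (red r) = j by rewrite rr size_monicM ?monicXn // size_polyXn si; lia.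
have srj : size r = j.
  by apply/eqP; rewrite eqn_leq -{2}srr size_poly andbT -ltnS -fs.
(* [r] and its reduction have the same size, so the leading coefficient of [r] survives modulo x. *)
have lr : lead_coef r \is a GRing.unit.
  apply: fconst_unit; rewrite -[fconst _]coef_map srj -srr -/(red r).
  by rewrite -lead_coefE lead_coef_eq0 -size_poly_eq0 srr; lia.
suff : (j <= j.-1)%N by lia.
apply: jmin; apply/asboolP; exists ((lead_coef r)^-1%:P * r); split.
- by rewrite monicE lead_coefM lead_coefC mulVr.
- rewrite mul_polyC size_scale ?srj ?prednK //; last by rewrite invr_eq0; apply: contraTneq lr => ->; rewrite unitr0.
  lia.
exact: (ideal_mulr Iid).
Qed.

End PolyIdeals.

(** * Parametrized rings and their Apery levels *)

(* [e l] maps a polynomial over K[[x]] to the [l]-th component, in K[[t_l]], of its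
   value at a generator over K[[x]] of the ring under consideration. *)
Record parametrization (K : fieldType) (d : nat)
    (e : 'I_d -> {rmorphism {poly fps K} -> fps K}) (omega : {ffun 'I_d -> nat}) : Prop :=
  Parametrization {
    par_C : forall l c, e l (fpsC c)%:P = fpsC c;
    par_X : forall l, has_order (e l (constX K)) (omega l);
    par_gt0 : forall l, (0 < omega l)%N;
    par_conductor : exists c, forall s : 'I_d -> fps K, (forall l, vge (s l) c) ->
      exists p, forall l, e l p = s l;
    par_monic : exists n, monic_deg (fun p => forall l, e l p = 0) n }.

Section Parametrized.
Variables (K : fieldType) (infK : infinite_set [set: K]) (d : nat).
Variables (e : 'I_d -> {rmorphism {poly fps K} -> fps K}).
Local Notation Nd := {ffun 'I_d -> nat}.
Variable omega : Nd.
Hypothesis par : parametrization e omega.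
Local Notation A := {poly fps K}.
Local Notation X := (constX K).
Implicit Types (f p q r : A) (a b : Nd) (l k : 'I_d).

Definition val_ge a p : Prop := forall l, vge (e l p) (a l).
Definition vals : set Nd := [set a | exists p, forall l, has_order (e l p) (a l)].
Definition Evals : set Nd := [set omega + s | s in vals].

Lemma val_ge_ideal a : poly_ideal (val_ge a).
Proof.
split=> [p q ap aq l|p q aq l]; first by rewrite rmorphD; apply: vgeD.
by rewrite rmorphM; apply: vgeMl.
Qed.

Lemma ker_ideal : poly_ideal (fun p => forall l, e l p = 0).
Proof.
split=> [p q p0 q0 l|p q q0 l]; first by rewrite rmorphD p0 q0 addr0.
by rewrite rmorphM q0 mulr0.
Qed.

Lemma val_geW a a' p : cw_le a a' -> val_ge a' p -> val_ge a p.
Proof. by move=> aa' ap l; apply: vgeW (ap l). Qed.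

Lemma e_C l c p : e l ((fpsC c)%:P * p) = fpsC c * e l p.
Proof. by rewrite rmorphM (par_C par). Qed.

Lemma val_geC a c p : val_ge a p -> val_ge a ((fpsC c)%:P * p).
Proof. exact: (ideal_mulr (val_ge_ideal a)). Qed.

(** The conductor supplies an element that is zero where [p] is not, and of order beyond [a] where
    [p] is zero. *)
Lemma fill_zeros a p : exists q, forall l,
  (e l p != 0 -> e l (p + q) = e l p) /\
  (e l p = 0 -> exists2 n, (a l < n)%N & has_order (e l (p + q)) n).
Proof.
have [c cP] := par_conductor par.
have [|q qE] := cP (fun l => if e l p == 0 then fpsX K ^+ (c + (a l).+1) else 0).
  move=> l; case: ifP => // _.
  by apply: vgeW (has_order_vge (has_order_fpsXn K _)); rewrite leq_addr.
exists q => l; rewrite rmorphD qE; split=> [/negbTE->|->]; first by rewrite addr0.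
exists (c + (a l).+1)%N; first by rewrite -ltnS -addnS ltn_addl.
by rewrite eqxx add0r; apply: has_order_fpsXn.
Qed.

Lemma has_orders p : (forall l, e l p != 0) -> exists a, forall l, has_order (e l p) (a l).
Proof.
move=> p0; have /choice[f fP] l : exists n, has_order (e l p) n by apply: has_order_ex.
by exists [ffun l => f l] => l; rewrite ffunE.
Qed.

Lemma regularize a p : exists q b,
  [/\ forall l, has_order (e l (p + q)) (b l),
      forall l, e l p != 0 -> e l (p + q) = e l p,
      forall l, has_order (e l (X * (p + q))) (omega l + b l) &
      forall l, e l p = 0 -> (a l < b l)%N].
Proof.
have [q qP] := fill_zeros a p; exists q.
have [|b bP] := @has_orders (p + q).
  move=> l; have [n0 z] := qP l; have [/z[n _ /has_order_neq0]//|p0] := eqVneq (e l p) 0.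
  by rewrite n0.
exists b; split=> // [l|l|l p0]; first by case: (qP l).
  by rewrite rmorphM; apply: has_orderM => //; apply: (par_X par l).
by have [_ /(_ p0)[n an nP]] := qP l; rewrite (has_order_inj (bP l) nP).
Qed.

Lemma jump_valsP a l :
  jump vals a l <-> exists p, val_ge a p /\ has_order (e l p) (a l).
Proof.
split=> [[s [[p pP] as_ sl]]|[p [ap pl]]].
  exists p; split; last by rewrite -sl.
  by move=> k; apply: vgeW (has_order_vge (pP k)).
have [q [b [bP keep _ big]]] := regularize a p.
exists b; split; first by exists (p + q).
  move=> k; have [/big/ltnW//|pk] := eqVneq (e k p) 0.
  by apply: vge_has_order (bP k); rewrite keep.
by by have := bP l; rewrite (keep l (has_order_neq0 pl)) => /has_order_inj/(_ pl).
Qed.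

Lemma jump_EvalsP a l :
  jump Evals a l <-> exists p, val_ge a (X * p) /\ has_order (e l (X * p)) (a l).
Proof.
split=> [[_ [[s [p pP] <-] as_ sl]]|[p [ap pl]]].
  have Xp k : has_order (e k (X * p)) ((omega + s)%R k).
    by rewrite rmorphM ffnatD; apply: has_orderM => //; apply: (par_X par k).
  exists p; split; last by rewrite -sl.
  by move=> k; apply: vgeW (has_order_vge (Xp k)).
have [q [b [bP keep Xb big]]] := regularize a p.
exists (omega + b); split; first by exists b => //; exists (p + q).
  move=> k; rewrite ffnatD; have [/big/ltnW|pk] := eqVneq (e k p) 0.
    by move=> ab; apply: leq_trans ab (leq_addl _ _).
  by apply: vge_has_order (Xb k); rewrite rmorphM keep // -rmorphM; apply: ap.
have pl0 : e l p != 0.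
  by have := has_order_neq0 pl; rewrite rmorphM mulf_eq0 negb_or => /andP[].
by rewrite ffnatD; have := Xb l; rewrite rmorphM keep // -rmorphM => /has_order_inj/(_ pl).
Qed.

Lemma Evals_sub : Evals `<=` vals.
Proof.
move=> _ [s [p pP] <-]; exists (X * p) => l; rewrite rmorphM ffnatD.
by apply: has_orderM => //; apply: (par_X par l).
Qed.

(** At every coordinate [p] or [q] attains the minimum; a generic combination attains it at all of
    them. *)
Lemma vals_meet : meet_closed vals.
Proof.
move=> a b [p pP] [q qP]; pose m := cw_min a b.
have pm l : vge (e l p) (m l) by apply: vgeW (has_order_vge (pP l)); rewrite ffunE geq_minl.
have qm l : vge (e l q) (m l) by apply: vgeW (has_order_vge (qP l)); rewrite ffunE geq_minr.
have [|c cP] := @avoid_scalar K infK _ (fun l => fcoef (e l p) (m l)) (fun l => fcoef (e l q) (m l)).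
  move=> l; rewrite /m ffunE /minn; case: ifP => _; first by left; case: (pP l).
  by right; case: (qP l).
exists (p + (fpsC c)%:P * q) => l; split.
  by rewrite rmorphD e_C fcoefD fcoefCM; apply: cP.
by rewrite rmorphD e_C; apply: vgeD => //; apply: vgeMl.
Qed.

Lemma Evals_meet : meet_closed Evals.
Proof.
move=> _ _ [s Ss <-] [t St <-]; exists (cw_min s t); first exact: vals_meet.
by apply/ffunP => l; rewrite !(ffnatD, ffunE) addn_minr.
Qed.

Lemma cancel_coef p q n l : vge (e l p) n -> has_order (e l q) n ->
  exists c, vge (e l (p - (fpsC c)%:P * q)) n.+1.
Proof.
move=> pn [qn qv]; exists (fcoef (e l p) n / fcoef (e l q) n).
rewrite rmorphB e_C; apply: vgeS; first by apply: vgeB => //; apply: vgeMl.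
by rewrite fcoefB fcoefCM divfK ?subrr //; apply/eqP.
Qed.

(** A multiple of [q] cancels the leading term of [p] at [l]; at [k] the order of [q] is too large
    to interfere. *)
Lemma vals_exchange a g k l : vals a -> vals g -> cw_le a g ->
  g l = a l -> (a k < g k)%N ->
  exists h, [/\ vals h, cw_le a h, (a l < h l)%N & h k = a k].
Proof.
move=> [p pP] [q qP] ag gl gk.
have qv j : vge (e j q) (a j) by apply: vgeW (has_order_vge (qP j)).
have [|c cP] := @cancel_coef p q (a l) l (has_order_vge (pP l)).
  by rewrite -gl.
set r := p - _ in cP.
have ra : val_ge a r.
  by apply: ideal_sub (val_ge_ideal a) _ (val_geC c qv) => j; apply: has_order_vge.
have rk : has_order (e k r) (a k).
  split; last exact: ra.
  rewrite rmorphB e_C fcoefB fcoefCM.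
  rewrite [X in _ - _ * X](has_order_vge (qP k)) // mulr0 subr0; exact: (pP k).1.
have [t [b [bP keep _ big]]] := regularize (inc a l) r.
exists b; split; first by exists (r + t).
- move=> j; have [rj|rj] := eqVneq (e j r) 0.
    exact: ltnW (leq_ltn_trans (inc_ge a l j) (big j rj)).
  by apply: vge_has_order (bP j); rewrite keep.
- have [rj|rj] := eqVneq (e l r) 0.
    exact: leq_ltn_trans (inc_ge a l l) (big l rj).
  by apply: vge_has_order (bP l); rewrite keep.
by have := bP k; rewrite (keep k (has_order_neq0 rk)) => /has_order_inj/(_ rk).
Qed.

Lemma monic_deg_val_ge a : exists n, monic_deg (val_ge a) n.
Proof.
have [n [P [Pm sP P0]]] := par_monic par.
by exists n, P; split=> // l; rewrite P0.
Qed.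

Let lam_ex a : exists n, `[< monic_deg (val_ge a) n >].
Proof. by have [n an] := monic_deg_val_ge a; exists n; apply/asboolP. Qed.

(* [lam a] is the codimension in [R] of the ideal [R(a) + xR], where [R] is the
   parametrized ring and [R(a)] the ideal of elements of value at least [a]. *)
Definition lam a : nat := ex_minn (lam_ex a).

Lemma lamP a : monic_deg (val_ge a) (lam a).
Proof. by rewrite /lam; case: ex_minnP => n /asboolP. Qed.

Lemma lam_min a n : monic_deg (val_ge a) n -> (lam a <= n)%N.
Proof. by rewrite /lam; case: ex_minnP => m _ min_m an; apply/min_m/asboolP. Qed.

Lemma lam_red a p : val_ge a p -> red p != 0 -> (lam a <= (size (red p)).-1)%N.
Proof.
by move=> ap p0; apply/lam_min/monic_deg_red => //;
  [apply: val_ge_ideal|apply: monic_deg_val_ge].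
Qed.

Lemma lam_le a a' : cw_le a a' -> (lam a <= lam a')%N.
Proof.
move=> aa'; apply: lam_min; have [f [fm fs fv]] := lamP a'.
by exists f; split=> //; apply: val_geW fv.
Qed.

Lemma val_ge_inc a l p : val_ge a p -> vge (e l p) (a l).+1 -> val_ge (inc a l) p.
Proof. by move=> ap pl k; rewrite ffunE; case: eqP => [->|_]; rewrite ?addn1 ?addn0. Qed.

Lemma val_ge_incS a l p : val_ge (inc a l) p -> vge (e l p) (a l).+1.
Proof. by move=> /(_ l); rewrite ffunE eqxx addn1. Qed.

Lemma has_order_or_vgeS f n l : vge (e l f) n -> has_order (e l f) n \/ vge (e l f) n.+1.
Proof.
move=> fn; have [f0|f0] := eqVneq (fcoef (e l f) n) 0; first by right; apply: vgeS.
by left; split=> //; apply/eqP.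
Qed.

(** If the minimal monic [f] has order exactly a_l at [l], the variable times [f], minus a scalar
    multiple of [f], has larger order there. *)
Lemma lam_inc_le a l : (lam (inc a l) <= (lam a).+1)%N.
Proof.
have [f [fm fs fv]] := lamP a; have [fl|fl] := has_order_or_vgeS (fv l); last first.
  apply: leqW; apply: lam_min; exists f; split=> //; exact: val_ge_inc.
have Xfv : val_ge a ('X * f) by apply: (ideal_mulr (val_ge_ideal a)).
have [c cP] := cancel_coef (Xfv l) fl; apply: lam_min.
have sXf : size ('X * f) = (lam a).+2 by rewrite mulrC size_mulX ?monic_neq0 // fs.
have lt : (size (- ((fpsC c)%:P * f))%R < size ('X * f)%R)%N.
  by rewrite size_polyN sXf ltnS -fs mul_polyC size_scale_leq.
exists ('X * f - (fpsC c)%:P * f); split.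
- by rewrite monicE lead_coefDl // -monicE monicMl ?monicX.
- by rewrite size_polyDl.
by apply: val_ge_inc cP; apply: ideal_sub (val_ge_ideal a) _ (val_geC _ _).
Qed.

Lemma lam_nojump a l : ~ jump vals a l -> lam (inc a l) = lam a.
Proof.
move=> /jump_valsP nj; apply/eqP; rewrite eqn_leq (lam_le (@inc_ge _ a l)) andbT.
have [f [fm fs fv]] := lamP a; apply: lam_min; exists f; split=> //.
apply: val_ge_inc => //; have [fl|//] := has_order_or_vgeS (fv l).
by case: nj; exists f.
Qed.

(** The witness is a multiple of x, so correcting the minimal monic by it raises the order at [l]
    and keeps the reduction modulo x, whose degree bounds [lam]. *)
Lemma lam_jumpE a l : jump Evals a l -> lam (inc a l) = lam a.
Proof.
move=> /jump_EvalsP[p [Xpv Xpl]]; apply/eqP; rewrite eqn_leq (lam_le (@inc_ge _ a l)) andbT.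
have [f [fm fs fv]] := lamP a; have [c cP] := cancel_coef (fv l) Xpl.
have rE : red (f - (fpsC c)%:P * (X * p)) = red f.
  by rewrite /red rmorphB mulrCA !rmorphM /= -/(red X) red_constX mul0r subr0.
have [rm rs] := red_monic fm.
have := @lam_red (inc a l) (f - (fpsC c)%:P * (X * p)).
rewrite rE rs fs monic_neq0 //; apply=> //.
by apply: val_ge_inc cP; apply: ideal_sub (val_ge_ideal a) _ (val_geC _ _).
Qed.

(** Otherwise some monic of degree [lam a] has value at least [inc a l]. The remainder of the
    witness modulo it still has order a_l at [l], but degree below [lam a]; so it vanishes modulo x
    and gives a jump of [Evals]. *)
Lemma lam_jump a l : jump vals a l -> ~ jump Evals a l -> lam (inc a l) = (lam a).+1.
Proof.
move=> /jump_valsP[p [pv pl]] nE; apply/eqP; rewrite eqn_leq lam_inc_le ltnNge.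
apply/negP => le_lam; apply: nE; apply/jump_EvalsP.
have [f [fm fs fv]] := monic_deg_up (val_ge_ideal (inc a l)) le_lam (lamP _).
have [u [r [pE sr]]] := monic_division p fm.
have fva := val_geW (@inc_ge _ a l) fv.
have rE : r = p - u * f by rewrite pE addrAC subrr add0r.
have rv : val_ge a r.
  by rewrite rE; apply: ideal_sub (val_ge_ideal a) pv _; apply: (ideal_mulr (val_ge_ideal a)).
have rl : has_order (e l r) (a l).
  split; last exact: rv.
  rewrite rE rmorphB rmorphM fcoefB.
  rewrite (vgeMl (e l u) (val_ge_incS fv)) // subr0; exact: pl.1.
have /red_eq0[r' r'E] : red r = 0.
  apply/eqP; apply: contraT => r0; have := lam_red rv r0.
  have : (size (red r) <= lam a)%N by apply: leq_trans (size_poly _ _) _; rewrite -ltnS -fs.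
  by have := r0; rewrite -size_poly_eq0; case: (size _) => // n _ /leq_trans h /h; rewrite ltnn.
by exists r'; rewrite -r'E.
Qed.

(** * The rank over K[[x]] *)

Let ker p := forall l, e l p = 0.
Let rank_ex : exists n, `[< monic_deg ker n >].
Proof. by have [n an] := par_monic par; exists n; apply/asboolP. Qed.
Definition rank : nat := ex_minn rank_ex.

(** Far out, the minimal monic takes a value in xR; subtracting a multiple of x moves it into the
    kernel with the same reduction modulo x. *)
Lemma lam_cap : exists c, forall a, cw_le c a -> lam a = rank.
Proof.
have [c cP] := par_conductor par; exists [ffun l => (omega l + c)%N] => a ca.
have [/asboolP Pn Pmin] : `[< monic_deg ker rank >] /\
    forall n, `[< monic_deg ker n >] -> (rank <= n)%N by rewrite /rank; case: ex_minnP.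
have {}Pmin n : monic_deg ker n -> (rank <= n)%N by move=> ?; apply/Pmin/asboolP.
apply/eqP; rewrite eqn_leq; apply/andP; split.
  by apply: lam_min; have [P [Pm Ps P0]] := Pn; exists P; split=> // l; rewrite P0.
have [f [fm fs fv]] := lamP a.
have /choice[s sP] l : exists q : fps K, e l f = e l X * q /\ vge q c.
  have [|q fq qc] := @fps_div _ (e l X) (e l f) (omega l) c (par_X par l); last by exists q.
  by apply: vgeW (fv l); have := ca l; rewrite ffunE.
have [|b bP] := cP s; first by move=> l; case: (sP l).
have kf : ker (f - X * b).
  by move=> l; rewrite rmorphB rmorphM bP (sP l).1 subrr.
have rE : red (f - X * b) = red f.
  by rewrite /red rmorphB !rmorphM /= -/(red X) red_constX mul0r subr0.
have [rm rs] := red_monic fm.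
have := @monic_deg_red _ ker (f - X * b) ker_ideal (par_monic par) kf.
by rewrite rE rs fs monic_neq0 // => /(_ isT)/Pmin.
Qed.

Lemma lam0 : lam 0 = 0%N.
Proof.
apply/eqP; rewrite -leqn0; apply: lam_min; exists 1; split; rewrite ?monic1 ?size_poly1 //.
by move=> l i; rewrite ffunE.
Qed.

(** An element has value at least this exactly when its product with x^k has value at least [a];
    hence the truncation at 0. *)
Definition shift_down (k : nat) a : Nd := [ffun l => (a l - k * omega l)%N].

Lemma shift_down0 a : shift_down 0 a = a.
Proof. by apply/ffunP => l; rewrite ffunE subn0. Qed.

Lemma jump_Evals_shift a l : jump Evals a l <->
  (omega l <= a l)%N /\ jump vals (shift_down 1 a) l.
Proof.
split=> [[_ [[s Ss <-] as_ sl]]|[wl [s [Ss as_ sl]]]].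
  move: sl; rewrite ffnatD => sl; split; first by rewrite -sl leq_addr.
  exists s; split=> // [k|]; last by rewrite ffunE -sl mul1n addKn.
  by rewrite ffunE mul1n leq_subLR -ffnatD; apply: as_.
exists (omega + s); split; first by exists s.
  by move=> k; rewrite ffnatD -leq_subLR; have := as_ k; rewrite ffunE mul1n.
by rewrite ffnatD sl ffunE mul1n subnKC.
Qed.

Let jumpb (k : nat) a l : bool := (k * omega l <= a l)%N && `[< jump vals (shift_down k a) l >].

(** A jump of [Evals] at one shift is a jump of [vals] at the next. So the growth of [lam] at shift
    k is a difference of consecutive indicators, and the sum over k telescopes. *)
Lemma lam_shift_down_step (k : nat) a l :
  (lam (shift_down k (inc a l)) + jumpb k.+1 a l = lam (shift_down k a) + jumpb k a l)%N.
Proof.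
rewrite /jumpb; have [kl|lk] := leqP (k * omega l)%N (a l); last first.
  rewrite [(k.+1 * _)%N]mulSn [(_ + _ <= a l)%N]leqNgt ltn_addl //=; congr (lam _ + _)%N.
  apply/ffunP => j; rewrite !ffunE; case: eqP => [->|_]; last by rewrite addn0.
  by rewrite addn1; lia.
have -> : shift_down k (inc a l) = inc (shift_down k a) l.
  apply/ffunP => j; rewrite !ffunE; case: eqP => [->|_]; last by rewrite !addn0.
  by rewrite !addn1 subSn.
have E : jump Evals (shift_down k a) l <->
    (k.+1 * omega l <= a l)%N && `[< jump vals (shift_down k.+1 a) l >].
  have -> : shift_down k.+1 a = shift_down 1 (shift_down k a).
    by apply/ffunP => j; rewrite !ffunE mulSn mul1n; lia.
  rewrite jump_Evals_shift ffunE; have -> : (omega l <= a l - k * omega l)%N = (k.+1 * omega l <= a l)%N.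
    by rewrite mulSn; lia.
  by split=> [[-> /asboolT->]|/andP[-> /asboolP]].
case: (asboolP (jump vals (shift_down k a) l)) => /= jS; last first.
  rewrite lam_nojump //; case: (boolP (_ && _)) => [/E[s [/Evals_sub Ss as_ sl]]|//].
  by case: jS; exists s.
case: (boolP (_ && _)) => [/E jE|/negP nb]; first by rewrite lam_jumpE.
by rewrite lam_jump ?addn0 ?addn1 // => /E.
Qed.

Let G M a : nat := (\sum_(k < M) lam (shift_down k a))%N.

Lemma lam_shift_down_sum M a l : (a l < M * omega l)%N -> jump vals a l ->
  G M (inc a l) = (G M a).+1.
Proof.
move=> aM jS; suff : (G M (inc a l) + jumpb M a l = G M a + jumpb 0 a l)%N.
  rewrite /jumpb [(M * _ <= _)%N]leqNgt aM shift_down0 mul0n leq0n /=.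
  by rewrite asboolT // addn0 addn1.
elim: (M) => [|n IH]; first by rewrite /G !big_ord0.
rewrite /G !big_ord_recr /= -addnA lam_shift_down_step.
by rewrite addnCA -/(G n (inc a l)) IH addnCA addnA.
Qed.

(* [G M] computes the codimension of [R(a)], which grows by one at each step above
   the conductor; from [c] to [c + omega] it grows by [lam (c + omega)]. *)
Lemma rank_sum : rank = (\sum_l omega l)%N.
Proof.
have [c1 c1P] := lam_cap; have [c2 c2P] := par_conductor par.
pose c : Nd := [ffun l => maxn (c1 l) c2].
have jS a l : cw_le c a -> jump vals a l.
  move=> ca; exists a; split=> //.
  have [|p pE] := c2P (fun k => fpsX K ^+ a k).
    move=> k; apply: vgeW (has_order_vge (has_order_fpsXn K _)).
    by apply: leq_trans (ca k); rewrite ffunE leq_maxr.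
  by exists p => k; rewrite pE; apply: has_order_fpsXn.
(* Each omega_l is at least 1, so M shifts bring [c] down to 0. *)
pose M := (\sum_l c l).+1.
have cM l : (c l < M * omega l)%N.
  apply: leq_trans (leq_pmulr _ (par_gt0 par l)).
  by rewrite ltnS (bigD1 l) //= leq_addr.
have step a : cw_le a (c + omega) -> cw_le c a ->
    G M.+1 (c + omega) = (G M.+1 a + \sum_l (c l + omega l - a l))%N.
  move: a; apply: path_ind => [_|a l _ al IH ca].
    rewrite big1 ?addn0 // => l _; rewrite ffnatD subnn //.
  rewrite IH; last exact: cw_le_trans (inc_ge a l).
  rewrite lam_shift_down_sum; last exact: jS; last first.
    by apply: leq_trans al _; rewrite ffnatD mulSn; have := cM l; lia.
  rewrite addSnnS; congr (_ + _)%N; rewrite (bigD1 l) //= [RHS](bigD1 l) //= -addSn.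
  congr (_ + _)%N; last by apply: eq_bigr => j /negbTE jl; rewrite [inc a l j]ffunE jl addn0.
  by move: al; rewrite ffnatD [inc a l l]ffunE eqxx addn1; lia.
have cw : cw_le c (c + omega) by move=> l; rewrite ffnatD leq_addr.
have := step c cw (@cw_le_refl _ c).
(* Shift k + 1 of c + omega is shift k of c, so the sums differ only in [lam (c + omega)], the rank,
   and [lam 0], which is 0. *)
rewrite /G big_ord_recl [in RHS]big_ord_recr /= shift_down0 c1P; last first.
  by apply: cw_le_trans cw => l; rewrite ffunE leq_maxl.
have -> : shift_down M c = 0 by apply/ffunP => l; rewrite !ffunE; have := cM l; rewrite ffunE; lia.
rewrite lam0 addn0 addnC.
have -> : (\sum_(i < M) lam (shift_down (bump 0 i) (c + omega)%R) = \sum_(i < M) lam (shift_down i c))%N.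
  apply: eq_bigr => i _; congr lam; apply/ffunP => l.
  by rewrite [LHS]ffunE [RHS]ffunE ffnatD /bump leq0n mulSn; lia.
by move/addnI->; apply: eq_bigr => l _; rewrite addKn.
Qed.

(** Where the minimal monic exceeds [a], the remainder modulo it of an element of value [a] has
    exact order; a generic multiple of this remainder, of smaller degree, is added. *)
Lemma exact_monic a : vals a -> exists f,
  [/\ f \is monic, size f = (lam a).+1 & forall l, has_order (e l f) (a l)].
Proof.
move=> [p pP]; have [f [fm fs fv]] := lamP a.
have [u [r [pE sr]]] := monic_division p fm.
have rv : val_ge a r.
  have -> : r = p - u * f by rewrite pE addrAC subrr add0r.
  apply: ideal_sub (val_ge_ideal a) _ (ideal_mulr (val_ge_ideal a) u fv).
  by move=> l; apply: has_order_vge.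
have [|c cP] := @avoid_scalar K infK _ (fun l => fcoef (e l f) (a l)) (fun l => fcoef (e l r) (a l)).
  move=> l; have [f0|f0] := eqVneq (fcoef (e l f) (a l)) 0; last by left; apply/eqP.
  right=> r0; case: (pP l) => + _; apply; rewrite pE rmorphD rmorphM fcoefD r0 addr0.
  exact: (vgeMl (e l u) (vgeS (fv l) f0)).
have lt : (size ((fpsC c)%:P * r)%R < size f)%N.
  by rewrite mul_polyC; apply: leq_ltn_trans (size_scale_leq _ _) sr.
exists (f + (fpsC c)%:P * r); split=> [||l].
- by rewrite monicE lead_coefDl // -monicE.
- by rewrite size_polyDl.
split; first by rewrite rmorphD e_C fcoefD fcoefCM; apply: cP.
by rewrite rmorphD e_C; apply: vgeD; [apply: fv|apply/vgeMl/rv].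
Qed.

Lemma level_vals i : (0 < d)%N -> (i < \sum_(k < d) omega k)%N ->
  level vals omega i = [set a | (vals `\` Evals) a /\ lam a = i].
Proof.
move=> d0 iN; apply: (@level_lam d vals Evals lam rank) => //.
- exact: vals_meet.
- exact: Evals_meet.
- exact: vals_exchange.
- exact: lam_jump.
- exact: lam_nojump.
- exact: lam_jumpE.
- exact: lam_cap.
- by rewrite rank_sum.
by rewrite rank_sum.
Qed.

End Parametrized.

(** * Substituting y = x z *)

Section BlowUpLevels.
Variables (K : fieldType) (infK : infinite_set [set: K]) (d : nat).
Local Notation A := {poly fps K}.
Local Notation Nd := {ffun 'I_d -> nat}.
Local Notation X := (constX K).
Implicit Types (f g p q r : A) (a b : Nd) (l : 'I_d).

Lemma comp_XX_coef (p : A) j : (p \Po (X * 'X))`_j = p`_j * fpsX K ^+ j.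
Proof.
rewrite comp_polyE coef_sum.
under eq_bigr => i _ do rewrite exprMn -rmorphXn /= coefZ coefCM coefXn.
have [jp|pj] := ltnP j (size p); last first.
  rewrite nth_default // mul0r big1 // => i _; case: eqP => [ji|]; last by rewrite !mulr0.
  by have := ltn_ord i; rewrite -ji ltnNge pj.
rewrite (bigD1 (Ordinal jp)) //= eqxx mulr1 big1 ?addr0 // => i.
by rewrite -val_eqE /= eq_sym => /negbTE->; rewrite !mulr0.
Qed.

(* [X^i g(Y/X)], a polynomial in [Y] when [g] has degree at most [i]. *)
Definition homog i (g : A) : A := \poly_(j < i.+1) (g`_j * fpsX K ^+ (i - j)).

Lemma homog_comp i g : (size g <= i.+1)%N -> homog i g \Po (X * 'X) = X ^+ i * g.
Proof.
move=> sg; apply/polyP => j; rewrite comp_XX_coef -rmorphXn coefCM coef_poly.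
case: ltnP => [ji|ij]; first by rewrite -mulrA -exprD subnK // mulrC.
by rewrite mul0r (nth_default 0 (leq_trans sg ij)) mulr0.
Qed.

Lemma homog_monic i g : g \is monic -> size g = i.+1 ->
  homog i g \is monic /\ size (homog i g) = i.+1.
Proof.
move=> gm sg; have gi : g`_i = 1 by move: gm; rewrite monicE lead_coefE sg => /eqP.
have hi : (homog i g)`_i = 1 by rewrite coef_poly ltnSn subnn gi mulr1.
have sh : size (homog i g) = i.+1.
  apply/eqP; rewrite eqn_leq size_poly ltnNge /=; apply/negP => /leq_sizeP/(_ i (leqnn i)).
  by rewrite hi => /eqP; rewrite oner_eq0.
by split=> //; rewrite monicE lead_coefE sh hi.
Qed.

(** Induction on the order of the leading coefficient, which bounds the exponent of x. *)
Lemma divX_power (p : A) : p != 0 ->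
  exists c g, [/\ p = X ^+ c * g, red g != 0 & (size g <= size p)%N].
Proof.
move=> p0; have /has_order_ex[n] : lead_coef p != 0 by rewrite lead_coef_eq0.
rewrite lead_coefE; move: (size p).-1 => j; elim: n p {p0} => [|n IH] p pn.
  exists 0%N, p; split; rewrite ?mul1r //; apply/eqP => /red_eq0[p' pE].
  by case: pn => + _; apply; rewrite pE coefCM fcoefXM.
have [/red_eq0[p' pE]|r0] := eqVneq (red p) 0; last by exists 0%N, p; split; rewrite ?mul1r.
have [|c [g [p'E g0 sg]]] := IH p'.
  apply: (@has_order_mulIl _ (fpsX K) _ 1); first exact: has_order_fpsX.
  by rewrite -coefCM -/X -pE.
exists c.+1, g; split=> //; first by rewrite exprS -mulrA -p'E.
apply: leq_trans sg _; apply/leq_sizeP => i pi; apply: (mulfI (has_order_neq0 (has_order_fpsX K))).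
by rewrite mulr0 -coefCM -/X -pE nth_default.
Qed.

(** For j > c, coefficient j of [g] is p_j x^(j-c), which vanishes modulo x. *)
Lemma comp_XX_divX (p : A) : p != 0 -> exists c g,
  [/\ p \Po (X * 'X) = X ^+ c * g, red g != 0, (size g <= size p)%N & (size (red g) <= c.+1)%N].
Proof.
move=> p0; have X0 : fpsX K != 0 := has_order_neq0 (has_order_fpsX K).
have [|c [g [pE g0 sg]]] := @divX_power (p \Po (X * 'X)).
  apply: contra p0 => /eqP/polyP pc; apply/eqP/polyP => j.
  have /eqP := pc j; rewrite comp_XX_coef coef0 mulf_eq0 expf_eq0 (negbTE X0) andbF orbF.
  by move/eqP.
have gj j : p`_j * fpsX K ^+ j = fpsX K ^+ c * g`_j.
  by rewrite -comp_XX_coef pE -rmorphXn coefCM.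
exists c, g; split=> //.
  apply/leq_sizeP => j pj; apply: (mulfI (expf_neq0 c X0)).
  by rewrite mulr0 -gj nth_default ?mul0r.
apply/leq_sizeP => j cj; rewrite coef_map /=.
have -> : g`_j = p`_j * fpsX K ^+ (j - c).
  apply: (mulfI (expf_neq0 c X0)); rewrite -gj mulrCA -exprD subnKC //; exact: ltnW.
by rewrite rmorphM rmorphXn /= /fconst /= expr0n subn_eq0 leqNgt cj mulr0.
Qed.

(** * The blow-up ([e], evaluation at z) against O ([e'], evaluation at y = xz) *)

Variables (e e' : 'I_d -> {rmorphism A -> fps K}) (omega : Nd).
Hypotheses (par : parametrization e omega) (par' : parametrization e' omega).
Hypothesis e'E : forall l p, e' l p = e l (p \Po (X * 'X)).

Lemma e_Xn l i : has_order (e l (X ^+ i)) (omega l * i).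
Proof. by rewrite rmorphXn; apply/has_orderX/(par_X par). Qed.

Lemma e_homog l i g : (size g <= i.+1)%N -> e' l (homog i g) = e l (X ^+ i * g).
Proof. by move=> sg; rewrite e'E homog_comp. Qed.

Lemma val_ge_XnM i a b p : (forall l, b l <= a l + omega l * i)%N ->
  val_ge e a p -> forall l, vge (e l (X ^+ i * p)) (b l).
Proof.
move=> ba pv l; apply: vgeW (ba l) _; rewrite addnC rmorphM.
by apply: vgeM (pv l); apply/has_order_vge/e_Xn.
Qed.

Lemma lam_blowup_le i a b : (forall l, b l <= a l + omega l * i)%N ->
  (lam par a <= i)%N -> (lam par' b <= i)%N.
Proof.
move=> ba /(monic_deg_up (val_ge_ideal _ a))/(_ (lamP par a))[g [gm gs gv]].
have [hm hs] := homog_monic gm gs; apply: lam_min; exists (homog i g); split=> // l.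
by rewrite e_homog ?gs //; apply: val_ge_XnM ba gv l.
Qed.

Definition sub_omega a i : Nd := [ffun l => (a l - omega l * i)%N].

Lemma sub_omegaK a i l : (a l <= sub_omega a i l + omega l * i)%N.
Proof. by rewrite ffunE; lia. Qed.

Lemma val_ge_divX c g p a : p \Po (X * 'X) = X ^+ c * g -> val_ge e' a p ->
  val_ge e (sub_omega a c) g.
Proof.
move=> pE pv l; have [le|lt] := leqP (omega l * c)%N (a l); last first.
  by move=> j; rewrite ffunE (eqP (ltnW lt)).
apply: (vge_mulIl (e_Xn l c)); rewrite -rmorphM -pE -e'E ffunE subnKC //.
Qed.

Lemma monic_divX f i a : f \is monic -> size f = i.+1 -> val_ge e' a f ->
  lam par' a = i -> exists g, [/\ g \is monic, size g = i.+1 & f \Po (X * 'X) = X ^+ i * g].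
Proof.
move=> fm fs fv lami; have f0 := monic_neq0 fm.
have [c [g [fE g0 sg sr]]] := comp_XX_divX f0.
have X0 : fpsX K != 0 := has_order_neq0 (has_order_fpsX K).
have gj j : f`_j * fpsX K ^+ j = fpsX K ^+ c * g`_j.
  by rewrite -comp_XX_coef fE -rmorphXn coefCM.
have fi : f`_i = 1 by move: fm; rewrite monicE lead_coefE fs => /eqP.
(* The degree of [g] modulo x is at most [c], which bounds [lam] in the blow-up; homogenizing
   carries the bound over to O. *)
have ic : (i <= c)%N.
  rewrite -lami; apply: (@lam_blowup_le c (sub_omega a c)) => [l|]; first exact: sub_omegaK.
  apply: leq_trans (lam_red par (val_ge_divX fE fv) g0) _.
  by rewrite -ltnS prednK // lt0n size_poly_eq0.
(* The coefficient of T^i in f(xT) is exactly x^i. *)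
have ci : (c <= i)%N.
  rewrite leqNgt; apply/negP => ic'; have /eqP := gj i.
  rewrite fi mul1r -(subnKC (ltnW ic')) exprD -mulrA -{1}[_ ^+ i]mulr1 => /eqP.
  move=> /(mulfI (expf_neq0 i X0))/(congr1 (fun s => fconst s)).
  rewrite rmorph1 rmorphM rmorphXn /= /fconst /= expr0n subn_eq0 leqNgt ic' mul0r.
  by move/eqP; rewrite oner_eq0.
have {ic ci} cE : c = i by apply/eqP; rewrite eqn_leq ic ci.
subst c; have gi : g`_i = 1.
  by apply: (mulfI (expf_neq0 i X0)); rewrite -gj fi mul1r mulr1.
have sgi : size g = i.+1.
  apply/eqP; rewrite eqn_leq -{1}fs sg ltnNge; apply/negP => /leq_sizeP/(_ i (leqnn i)).
  by rewrite gi => /eqP; rewrite oner_eq0.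
by exists g; split=> //; rewrite monicE lead_coefE sgi gi.
Qed.

Lemma orders_divX f i g a : f \Po (X * 'X) = X ^+ i * g -> (forall l, has_order (e' l f) (a l)) ->
  exists2 b, a = b + omega *+ i & forall l, has_order (e l g) (b l).
Proof.
move=> fE fa; exists (sub_omega a i).
  apply/ffunP => l; rewrite ffnatD ffnatMn ffunE subnK //.
  by apply: vge_has_order (fa l); rewrite e'E fE rmorphM -[X in vge _ X]addn0;
     apply: vgeM => //; apply/has_order_vge/e_Xn.
move=> l; have := fa l; rewrite e'E fE rmorphM => h.
have le : (omega l * i <= a l)%N.
  apply: vge_has_order h; rewrite -[X in vge _ X]addn0.
  by apply: vgeM => //; apply/has_order_vge/e_Xn.
by apply: (has_order_mulIl (e_Xn l i)); rewrite ffunE subnKC.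
Qed.

Lemma nojump_not_Evals e1 a l : ~ jump (@Evals K d e1 omega) a l -> ~ Evals e1 omega a.
Proof. by move=> nj Ea; apply: nj; exists a; split=> //; apply: cw_le_refl. Qed.

Lemma val_ge_X_of a l p g i : (size p <= i)%N -> val_ge e a (X * p) ->
  has_order (e l (X * p)) (a l) -> jump (Evals e' omega) (a + omega *+ i) l.
Proof.
move=> sp pv pl; apply/(jump_EvalsP par'); exists (homog i p).
have E k : e' k (X * homog i p) = e k (X ^+ i * (X * p)).
  rewrite rmorphM e_homog ?(leqW sp) // e'E comp_polyC -rmorphM; congr (e k _).
  by rewrite mulrCA.
split=> [k|]; first by rewrite E; apply: val_ge_XnM pv k => j; rewrite ffnatD ffnatMn.
rewrite E rmorphM ffnatD ffnatMn addnC.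
by apply: has_orderM => //; apply: e_Xn.
Qed.

(** Since [p] has degree below [i], x^i p(z) is x times an element of O. *)
Lemma jump_homog a l p j i : (size p <= j.+1)%N -> (j < i)%N -> val_ge e a p ->
  has_order (e l p) (a l) -> jump (Evals e' omega) (a + omega *+ i) l.
Proof.
move=> sp ji pv pl; apply/(jump_EvalsP par'); exists (X ^+ (i - j).-1 * homog j p).
have E k : e' k (X * (X ^+ (i - j).-1 * homog j p)) = e k (X ^+ i * p).
  rewrite mulrA -exprS prednK ?subn_gt0 // rmorphM e_homog // e'E.
  by rewrite -rmorphXn comp_polyC rmorphXn -rmorphM mulrA -exprD subnK // ltnW.
split=> [k|]; first by rewrite E; apply: val_ge_XnM pv k => k'; rewrite ffnatD ffnatMn.
by rewrite E rmorphM ffnatD ffnatMn addnC; apply: has_orderM => //; apply: e_Xn.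
Qed.

Lemma level_O_sub b i : (0 < d)%N -> vals e' b -> ~ Evals e' omega b -> lam par' b = i ->
  exists a, [/\ b = a + omega *+ i, vals e a, ~ Evals e omega a & lam par a = i].
Proof.
move=> d0 Sb nEb lami.
have [l nj] : exists l, ~ jump (Evals e' omega) b l.
  by apply: (@A_nojumpE _ (vals e')) => //; apply: Evals_meet par'.
have [f [fm fs fb]] := exact_monic infK par' Sb; rewrite lami in fs.
have fv : val_ge e' b f by move=> k; apply: has_order_vge.
have [g [gm gs fE]] := monic_divX fm fs fv lami.
have [a bE ga] := orders_divX fE fb; exists a.
have gv : val_ge e a g by move=> k; apply: has_order_vge.
have noj p : (size p <= i)%N -> val_ge e a (X * p) -> ~ has_order (e l (X * p)) (a l).
  by move=> sp pv pl; apply: nj; rewrite bE; apply: val_ge_X_of pl.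
split=> //; first by exists g.
  apply: (@nojump_not_Evals _ _ l) => /(jump_EvalsP par)[p [pv pl]].
  (* Reduction modulo [g] bounds the degree; the discarded multiple of x g has order above a_l
     because omega_l is positive. *)
  have [u [r [pE sr]]] := monic_division p gm.
  have rE : X * r = X * p - X * u * g by rewrite pE mulrDr mulrA addrAC subrr add0r.
  apply: (@noj r); first by rewrite -ltnS -gs.
    rewrite rE; apply: ideal_sub (val_ge_ideal _ a) pv _.
    exact: (ideal_mulr (val_ge_ideal _ a)).
  split; last first.
    rewrite rE rmorphB; apply: vgeB; first exact: pv.
    by rewrite rmorphM; apply/vgeMl/gv.
  rewrite rE rmorphB fcoefB [X in _ - X](_ : _ = 0) ?subr0; first exact: pl.1.
  rewrite -mulrA rmorphM.
  have /vgeM/(_ (vgeMl (e l u) (gv l))) := has_order_vge (par_X par l).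
  by rewrite rmorphM; apply; rewrite -[X in (X < _)%N]add0n ltn_add2r (par_gt0 par l).
apply/eqP; rewrite eqn_leq; apply/andP; split.
  by apply: lam_min; exists g.
(* Either [g'] has order a_l at [l], or the remainder of [g] modulo [g'] has. Both have degree below
   [i], so either would produce a jump of [Evals] at [b]. *)
rewrite leqNgt; apply/negP => ltj; have [g' [g'm g's g'v]] := lamP par a.
have g'l : vge (e l g') (a l).+1.
  have [g'l|//] := has_order_or_vgeS (g'v l); case: nj.
  by rewrite bE; apply: jump_homog ltj g'v g'l; rewrite g's.
have [u [r [gE sr]]] := monic_division g g'm.
have rE : r = g - u * g' by rewrite gE addrAC subrr add0r.
have rv : val_ge e a r.
  rewrite rE; apply: ideal_sub (val_ge_ideal _ a) gv _.
  exact: (ideal_mulr (val_ge_ideal _ a)).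
have rl : has_order (e l r) (a l).
  split; last exact: rv.
  rewrite rE rmorphB fcoefB [X in _ - X](_ : _ = 0) ?subr0; first exact: (ga l).1.
  by rewrite rmorphM; apply: (vgeMl (e l u) g'l).
apply: nj; rewrite bE; apply: jump_homog ltj rv rl.
by apply: ltnW; rewrite -g's.
Qed.

Lemma level_O_sup a i : (0 < d)%N -> vals e a -> ~ Evals e omega a -> lam par a = i ->
  [/\ vals e' (a + omega *+ i), ~ Evals e' omega (a + omega *+ i) &
      lam par' (a + omega *+ i) = i].
Proof.
move=> d0 Sa nEa lami; set b := a + _.
have bE k : b k = (a k + omega k * i)%N by rewrite ffnatD ffnatMn.
have [l nj] : exists l, ~ jump (Evals e omega) a l.
  by apply: (@A_nojumpE _ (vals e)) => //; apply: Evals_meet par.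
have [g [gm gs ga]] := exact_monic infK par Sa; rewrite lami in gs.
have [fm fs] := homog_monic gm gs; set f := homog i g in fm fs.
have fb k : has_order (e' k f) (b k).
  rewrite e_homog ?gs // rmorphM bE addnC.
  by apply: has_orderM => //; apply: e_Xn.
have fv : val_ge e' b f by move=> k; apply: has_order_vge.
have sub_b c : (c <= i)%N -> cw_le a (sub_omega b c).
  by move=> ci k; rewrite ffunE bE; have := leq_mul (leqnn (omega k)) ci; lia.
have lamb : lam par' b = i.
  apply/eqP; rewrite eqn_leq; apply/andP; split; first by apply: lam_min; exists f.
  rewrite leqNgt; apply/negP => ltj; have [f' [f'm f's f'v]] := lamP par' b.
  have [g' [g'm g's f'E]] := monic_divX f'm f's f'v erefl.
  suff : (lam par a <= lam par' b)%N by rewrite lami leqNgt ltj.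
  apply: lam_min; exists g'; split=> //.
  exact: val_geW (sub_b _ (ltnW ltj)) (val_ge_divX f'E f'v).
split=> //; first by exists f.
apply: (@nojump_not_Evals _ _ l) => /(jump_EvalsP par')[p [pv pl]].
have [u [r [pE sr]]] := monic_division p fm; rewrite fs ltnS in sr.
have rE : X * r = X * p - X * u * f by rewrite pE mulrDr mulrA addrAC subrr add0r.
have rv : val_ge e' b (X * r).
  rewrite rE; apply: ideal_sub (val_ge_ideal _ b) pv _.
  exact: (ideal_mulr (val_ge_ideal _ b)).
have rl : has_order (e' l (X * r)) (b l).
  split; last exact: rv.
  rewrite rE rmorphB fcoefB [X in _ - X](_ : _ = 0) ?subr0; first exact: pl.1.
  rewrite -mulrA rmorphM.
  have /vgeM/(_ (vgeMl (e' l u) (fv l))) := has_order_vge (par_X par' l).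
  by rewrite rmorphM; apply; rewrite -[X in (X < _)%N]add0n ltn_add2r (par_gt0 par' l).
have Xr0 : X * r != 0.
  by apply/eqP => z; have := has_order_neq0 rl; rewrite z rmorph0 eqxx.
have sXr : (size (X * r)%R <= i)%N.
  by apply: leq_trans sr; rewrite mul_polyC size_scale_leq.
have [c [h [hE h0 sh _]]] := comp_XX_divX Xr0.
have hv := val_ge_divX hE rv.
(* If c is at most i, [h] has value at least [a] and degree below [i] modulo x, against
   [lam par a = i]. If c > i, x^(c-i) h is a multiple of x giving the jump excluded by the choice of
   [l]. *)
have [ci|ic] := leqP c i.
  have hva := val_geW (sub_b c ci) hv.
  have := lam_red par hva h0; rewrite lami.
  have : (size (red h) <= i)%N by apply: leq_trans (size_poly _ _) (leq_trans sh sXr).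
  have := h0; rewrite -size_poly_eq0; case: (size _) => // n _ /leq_trans k /k.
  by rewrite ltnn.
apply: nj; apply/(jump_EvalsP par); exists (X ^+ (c - i).-1 * h).
have hE' : X ^+ i * (X * (X ^+ (c - i).-1 * h)) = (X * r) \Po (X * 'X).
  rewrite hE [X * (_ * _)]mulrA -exprS prednK ?subn_gt0 // mulrA -exprD subnKC //.
  exact: ltnW.
split=> [k|]; last first.
  by apply: (has_order_mulIl (e_Xn l i)); rewrite -rmorphM hE' -e'E addnC -bE.
by apply: (vge_mulIl (e_Xn k i)); rewrite -rmorphM hE' -e'E addnC -bE; apply: rv.
Qed.

Lemma level_blowup i : (i < \sum_(k < d) omega k)%N ->
  level (vals e') omega i = [set a + omega *+ i | a in level (vals e) omega i].
Proof.
move=> iN; have d0 : (0 < d)%N.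
  by case: (posnP d) => // d0; move: iN; rewrite big1 // => k; have := ltn_ord k; rewrite {2}d0.
rewrite (level_vals infK par d0 iN) (level_vals infK par' d0 iN).
apply/seteqP; split=> [b [[Sb nEb] lb]|_ [a [[Sa nEa] la] <-]].
  by have [a [-> Sa nEa la]] := level_O_sub d0 Sb nEb lb; exists a.
by have [Sb nEb lb] := level_O_sup d0 Sa nEa la.
Qed.

End BlowUpLevels.

(** * Expansions in powers of x *)

Section XadicExpansion.
Variables (K : fieldType) (T : Type) (n : nat).
Variables (x : T -> fps K) (g : 'I_n -> T -> fps K) (M : (T -> fps K) -> Prop).
Hypothesis x1 : forall l, vge (x l) 1.
Hypothesis step : forall s, M s -> exists (c : 'I_n -> K) (s' : T -> fps K),
  M s' /\ forall l, s l = \sum_j fpsC (c j) * g j l + x l * s' l.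

(** The k-th coefficients of the series [S j] are the scalars found at the k-th application of
    [step]. *)
Lemma xadic_expansion s : M s -> exists S : 'I_n -> fps K,
  forall l, s l = \sum_j subst (x1 l) (S j) * g j l.
Proof.
have /choice[F FP] (t : T -> fps K) : exists cs : ('I_n -> K) * (T -> fps K), M t ->
    M cs.2 /\ forall l, t l = \sum_j fpsC (cs.1 j) * g j l + x l * cs.2 l.
  case: (pselect (M t)) => [/step[c [t' tP]]|nM]; first by exists (c, t').
  by exists ((fun=> 0), t).
pose next t := (F t).2.
pose S t j := Fps (fun k => (F (iter k next t)).1 j).
have SE t j : fshift (S t j) = S (next t) j.
  by apply: fpsP => k; rewrite /= -/(iter k.+1 next t) iterSr.
move=> Ms; exists (S s) => l; apply/eqP; rewrite -subr_eq0; apply/eqP.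
apply: vge_all => k; elim: k s Ms => // k IH s Ms.
have [Mn sE] := FP s Ms.
have E : \sum_j subst (x1 l) (S s j) * g j l =
    \sum_j fpsC ((F s).1 j) * g j l + x l * \sum_j subst (x1 l) (S (next s) j) * g j l.
  rewrite mulr_sumr -big_split; apply: eq_bigr => j _.
  by rewrite substS mulrDl -mulrA SE.
rewrite E {1}sE opprD addrACA subrr add0r -mulrBr -add1n.
by apply: vgeM => //; apply: IH.
Qed.

End XadicExpansion.

Section OneBranchSeries.
Variables (K : fieldType) (x : fps K) (w : nat).
Hypotheses (xw : has_order x w) (x1 : vge x 1).

Lemma clear_coefs c n (g : nat -> fps K) (s : fps K) : (forall j, has_order (g j) (c + j)) ->
  vge s c -> exists a : nat -> K, vge (s - \sum_(j < n) fpsC (a j) * g j) (c + n).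
Proof.
move=> gc sc; elim: n => [|n [a aP]].
  by exists (fun=> 0); rewrite big_ord0 subr0 addn0.
set t := s - _ in aP; have [gn gv] := gc n.
exists (fun j => if j == n then fcoef t (c + n) / fcoef (g n) (c + n) else a j).
rewrite big_ord_recr eqxx.
have -> : \sum_(j < n) fpsC (if val j == n then fcoef t (c + n) / fcoef (g n) (c + n) else a j) * g j =
    \sum_(j < n) fpsC (a j) * g j by apply: eq_bigr => j _; rewrite (ltn_eqF (ltn_ord j)).
rewrite opprD addrA -/t addnS; apply: vgeS; first by apply: vgeB => //; apply: vgeMl.
by rewrite fcoefB fcoefCM divfK ?subrr //; apply/eqP.
Qed.

(** Elements of orders c, ..., c + w - 1 clear [w] coefficients, and what remains is x times a
    series of order at least [c]. *)
Lemma series_generators c (g : nat -> fps K) (s : fps K) :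
  (forall j, has_order (g j) (c + j)) -> vge s c ->
  exists S : 'I_w -> fps K, s = \sum_j subst x1 (S j) * g j.
Proof.
move=> gc sc; pose M (t : unit -> fps K) := vge (t tt) c.
have [|S SE] := @xadic_expansion K unit w (fun=> x) (fun j _ => g j) M (fun=> x1) _ (fun=> s) sc.
- move=> t tc; have [a aP] := clear_coefs w gc tc.
  have [|q qE qc] := @fps_div _ x (t tt - \sum_(j < w) fpsC (a j) * g j) w c xw.
    by rewrite addnC.
  exists (fun j : 'I_w => a j), (fun=> q); split=> // -[].
  by rewrite -qE addrC subrK.
by exists S; apply: (SE tt).
Qed.

(** Determinant trick: 1, ..., t^(w-1) generate K[[t]] over K[[x]], and [P] is the characteristic
    polynomial of a matrix of multiplication by [z] on them. *)
Lemma series_integral (z : fps K) : exists P : {poly fps K},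
  P \is monic /\ (map_poly (subst x1) P).[z] = 0.
Proof.
have w0 : (0 < w)%N.
  by rewrite lt0n; apply/eqP => w0; case: xw => + _; rewrite w0; apply; apply: x1.
have gX j : has_order (fpsX K ^+ j) (0 + j) by rewrite add0n; apply: has_order_fpsXn.
have /choice[M MP] (j : 'I_w) : exists S : 'I_w -> fps K,
    z * fpsX K ^+ j = \sum_k subst x1 (S k) * fpsX K ^+ k.
  exact: (series_generators gX (@vge_0 _ _)).
pose N := \matrix_(j, k) M j k.
exists (char_poly N); split; first exact: char_poly_monic.
rewrite map_char_poly; set N' := map_mx _ N.
pose B := z%:M - N'; pose v := \col_(j < w) fpsX K ^+ j.
have Bv : B *m v = 0.
  apply/colP => j; rewrite mulmxBl mul_scalar_mx !mxE MP.
  by apply/eqP; rewrite subr_eq0; apply/eqP/eq_bigr => k _; rewrite !mxE.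
have detB : \det B = 0.
  have : \adj B *m B *m v = 0 by rewrite -mulmxA Bv mulmx0.
  (* The first entry of [v] is t^0 = 1. *)
  rewrite mul_adj_mx mul_scalar_mx => /colP/(_ (Ordinal w0)).
  by rewrite !mxE expr0 mulr1.
rewrite -[LHS]/(horner_eval z _) /char_poly -det_map_mx -[RHS]detB; congr (\det _).
apply/matrixP => i j; rewrite !mxE rmorphB rmorphMn /=.
by rewrite /horner_eval hornerX hornerC.
Qed.

End OneBranchSeries.

(** * Branches and curves *)

Section TwoVariableSeries.
Variable K : fieldType.
Local Notation R2 := (fps2 K).
Implicit Types (f g : R2) (c : K).

Definition cst c : R2 := fpsC (fpsC c).
Definition vX : R2 := fpsC (fpsX K).
Definition vY : R2 := fpsX (fps K).
Definition const2 f : K := fconst (fconst f).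

Lemma unit_fps2 f : const2 f != 0 -> exists g, g * f = 1.
Proof. by move=> f0; apply/unit_fps/fconst_unit. Qed.

Lemma const2D f g : const2 (f + g) = const2 f + const2 g. Proof. by []. Qed.
Lemma const2B f g : const2 (f - g) = const2 f - const2 g. Proof. by []. Qed.
Lemma const2M f g : const2 (f * g) = const2 f * const2 g.
Proof. by rewrite /const2 !rmorphM. Qed.

Lemma cst0 : cst 0 = 0. Proof. by rewrite /cst !rmorph0. Qed.

Lemma fps2_split c f : exists f1 f2, f = cst (const2 f) + (vX + cst c * vY) * f1 + vY * f2.
Proof.
exists (fpsC (fshift (fconst f))), (fshift f - cst c * fpsC (fshift (fconst f))).
rewrite {1}(fshiftE f) {1}(fshiftE (fconst f)) rmorphD rmorphM mulrDl mulrBr -!addrA.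
by congr (_ + (_ + _)); rewrite mulrA [vY * cst c]mulrC addrC subrK.
Qed.

(* The series [S(X + c Y)]. *)
Definition fps_at c (S : fps K) : R2 :=
  Fps (fun b => Fps (fun a => fcoef S (a + b) * c ^+ b *+ 'C(a + b, b))).

(* Pascal's rule *)
Lemma fps_at_rec c S : fps_at c S = cst (fconst S) + (vX + cst c * vY) * fps_at c (fshift S).
Proof.
apply: fpsP => b; apply: fpsP => a.
rewrite !fcoefD mulrDl fcoefD -mulrA -[cst c]/(fpsC (fpsC c)) !fcoefCM.
rewrite fcoefXM -[vY]/(fpsX (fps K)) fcoefXM.
case: b => [|b]; case: a => [|a]; rewrite ?fcoef0 ?mulr0 ?addr0 ?add0r /=.
- by rewrite bin0 mulr1.
- by rewrite !addn0 !bin0.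
- by rewrite !add0n !binn exprS mulrCA.
by rewrite addSn !addnS binS mulrnDr addSn mulrnAr exprS [c * (_ * _)]mulrCA.
Qed.

End TwoVariableSeries.

(** * A single branch *)

Section Branch.
Variables (K : fieldType) (phi : {rmorphism fps2 K -> fps K}).
Hypothesis phi_cst : forall c, phi (cst c) = fpsC c.
Hypothesis phi_frac : forall z : laurent K, exists f g,
  phi g != 0 /\ z = (phi f)%:F / (phi g)%:F.
Implicit Types (f g : fps2 K) (c : K).

(** If [g] without constant term had an image with constant term u nonzero, g - u would be a unit
    whose image is not one. *)
Lemma phi_const f : fconst (phi f) = const2 f.
Proof.
pose g := f - cst (const2 f).
have g0 : const2 g = 0 by rewrite const2B /const2 /= subrr.
have -> : phi f = phi g + fpsC (const2 f) by rewrite -phi_cst -rmorphD subrK.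
rewrite rmorphD /= [X in X + _](_ : _ = 0) ?add0r //.
set u := fconst (phi g); apply/eqP; apply: contraT => u0.
have [|h hE] := @unit_fps2 K (g - cst u); first by rewrite const2B g0 sub0r oppr_eq0.
have /eqP := congr1 (fun s => fconst (phi s)) hE.
rewrite [phi (h * _)]rmorphM [fconst (_ * _)]rmorphM [phi (g - _)]rmorphB phi_cst /= -[fcoef _ 0]/u.
by rewrite subrr mulr0 rmorph1 eq_sym oner_eq0.
Qed.

Lemma phi_vge1 f : const2 f = 0 -> vge (phi f) 1.
Proof. by move=> f0; apply: vge1; rewrite -[LHS]/(fconst _) phi_const. Qed.

Lemma phi_ratio : exists f g, phi g != 0 /\ phi f = fpsX K * phi g.
Proof.
have [f [g [g0 E]]] := phi_frac (fpsX K)%:F; exists f, g; split=> //.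
have gF : (phi g)%:F != 0 :> laurent K by rewrite tofrac_eq0.
by apply/eqP; rewrite -tofrac_eq rmorphM /= E divfK.
Qed.

Lemma phi_vXY : phi (vX K) <> 0 \/ phi (vY K) <> 0.
Proof.
apply: contrapT => /not_orP[/contrapT X0 /contrapT Y0].
have cE f : phi f = fpsC (const2 f).
  have [f1 [f2 {1}->]] := fps2_split 0 f.
  by rewrite !(rmorphD, rmorphM) /= !phi_cst X0 Y0 mulr0 addr0 !mul0r !addr0.
have [f [g [g0 E]]] := phi_ratio; case/eqP: g0.
have /(congr1 (fun s => fcoef s 1)) := E.
by rewrite !cE fcoefXM /= => <-; rewrite rmorph0.
Qed.

Variables (c : K) (w : nat).
Local Notation x := (vX K + cst c * vY K).
Hypothesis xw : has_order (phi x) w.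

Lemma phi_x1 : vge (phi x) 1.
Proof.
apply: phi_vge1; rewrite /const2 /fconst fcoefD fcoefM_0 fcoefD fcoefM_0 /=.
by rewrite mulr0 addr0.
Qed.

Lemma phi_fps_at (x1 : vge (phi x) 1) S : phi (fps_at c S) = subst x1 S.
Proof.
apply: (subst_uniq x1 (F := fun S => phi (fps_at c S))) => s.
by rewrite {1}fps_at_rec rmorphD rmorphM phi_cst.
Qed.

(* With two consecutive orders [b] and [b + 1], all orders from [b ^ 2] on occur. *)
Lemma phi_orders : exists b, forall k, (b <= k)%N -> exists f, has_order (phi f) k.
Proof.
have [f [g [g0 E]]] := phi_ratio; have [b gb] := has_order_ex g0.
have fb : has_order (phi f) b.+1 by rewrite E; apply: (has_orderM (has_order_fpsX K) gb).
exists (b * b)%N => k bk; exists (g ^+ (k %/ b - k %% b) * f ^+ (k %% b)).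
have kE : k = (b * (k %/ b - k %% b) + b.+1 * (k %% b))%N.
  case: (posnP b) => [->|b0]; first by rewrite mul0n modn0 mul1n.
  have rb : (k %% b < b)%N by rewrite ltn_mod.
  have qb : (b <= k %/ b)%N by rewrite leq_divRL.
  rewrite mulSn mulnBr addnCA subnK; last by rewrite leq_mul2l (leq_trans (ltnW rb)) ?orbT.
  by rewrite addnC mulnC -divn_eq.
by rewrite [X in has_order _ X]kE rmorphM !rmorphXn; apply: (has_orderM (has_orderX _ gb) (has_orderX _ fb)).
Qed.

(** Branch elements of all orders from [b] on generate t^b K[[t]] over K[[x]]. *)
Lemma branch_conductor : exists b, forall s, vge s b -> exists f, phi f = s.
Proof.
have [b bP] := phi_orders; exists b => s sb.
have /choice[G GP] j : exists f, has_order (phi f) (b + j) by apply: bP; rewrite leq_addr.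
have [S ->] := series_generators xw phi_x1 GP sb.
exists (\sum_j fps_at c (S j) * G j); rewrite rmorph_sum; apply: eq_bigr => j _.
by rewrite rmorphM (phi_fps_at phi_x1).
Qed.

End Branch.

(** * All branches together: conductor and generators of O over K[[x]] *)

Section Curve.
Variables (K : fieldType) (infK : infinite_set [set: K]) (d : nat).
Variables (H : 'I_d -> fps2 K) (phi : 'I_d -> {rmorphism fps2 K -> fps K}).
Hypothesis H_irr : forall i, irreducible_elt (H i).
Hypothesis H_coprime : forall i j, i != j -> coprime_elt (H i) (H j).
Hypothesis phi_cst : forall i c, phi i (cst c) = fpsC c.
Hypothesis phi_ker : forall i f, phi i f = 0 <-> divides (H i) f.
Hypothesis phi_frac : forall i (z : laurent K), exists f g,
  phi i g != 0 /\ z = (phi i f)%:F / (phi i g)%:F.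
Implicit Types (f g : fps2 K) (i j l : 'I_d).

Lemma phi_H_neq0 i j : i != j -> phi i (H j) != 0.
Proof.
move=> ij; apply/eqP => /phi_ker ijd.
have [_ /negP nu _] := H_irr i; apply: nu; apply: (H_coprime ij) => //.
by exists 1; rewrite mul1r.
Qed.

Lemma prod_divides f : (forall i, phi i f = 0) -> divides (\prod_(i < d) H i) f.
Proof.
move=> f0; rewrite -big_enum /=; have := enum_uniq 'I_d.
elim: (enum 'I_d) => [_|i r IH /= /andP[ir /IH[g fE]]].
  by exists f; rewrite big_nil mulr1.
have /phi_ker[h gE] : phi i g = 0.
  have /eqP := f0 i; rewrite fE rmorphM mulf_eq0 => /orP[/eqP//|].
  rewrite rmorph_prod prodf_seq_eq0 => /hasP[j jr /=].
  rewrite (negbTE (phi_H_neq0 _)) //; apply: contraNneq ir => ->; exact: jr.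
by exists h; rewrite big_cons fE gE mulrA.
Qed.

(** omega_i is the least order of X and Y on branch i; a generic X + cY attains it on all
    branches. *)
Lemma exists_transversal : exists (c : K) (omega : {ffun 'I_d -> nat}), forall i,
  [/\ (0 < omega i)%N, has_order (phi i (vX K + cst c * vY K)) (omega i) &
      vge (phi i (vY K)) (omega i)].
Proof.
have /choice[w wP] i : exists n, [/\ vge (phi i (vX K)) n, vge (phi i (vY K)) n &
    fcoef (phi i (vX K)) n <> 0 \/ fcoef (phi i (vY K)) n <> 0].
  have ex : exists n, (fcoef (phi i (vX K)) n != 0) || (fcoef (phi i (vY K)) n != 0).
    have [/eqP/has_order_ex[n [n0 _]]|/eqP/has_order_ex[n [n0 _]]] :=
      phi_vXY (phi_cst i) (phi_frac i); exists n; apply/orP; [left|right]; exact/eqP.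
  case: (ex_minnP ex) => n /orP n0 min_n; exists n; split.
  - move=> k kn; apply/eqP; apply: contraTT kn => k0; rewrite -leqNgt.
    by apply: min_n; rewrite k0.
  - move=> k kn; apply/eqP; apply: contraTT kn => k0; rewrite -leqNgt.
    by apply: min_n; rewrite k0 orbT.
  by case: n0 => /eqP; [left|right].
have [|c cP] := @avoid_scalar K infK _ (fun i => fcoef (phi i (vX K)) (w i))
    (fun i => fcoef (phi i (vY K)) (w i)); first by move=> i; case: (wP i).
exists c, [ffun i => w i] => i; rewrite ffunE; have [Xw Yw _] := wP i.
have xw : has_order (phi i (vX K + cst c * vY K)) (w i).
  split; rewrite rmorphD rmorphM phi_cst; last by apply: vgeD => //; apply: vgeMl.
  by rewrite fcoefD fcoefCM.
split=> //; apply: vge_has_order xw; exact: phi_x1 (phi_cst i) c.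
Qed.

Variables (c : K) (omega : {ffun 'I_d -> nat}).
Local Notation x := (vX K + cst c * vY K).
Local Notation y := (vY K).
Hypothesis x_order : forall i, has_order (phi i x) (omega i).
Hypothesis omega_gt0 : forall i, (0 < omega i)%N.
Hypothesis y_order : forall i, vge (phi i y) (omega i).

Let x1 i : vge (phi i x) 1 := phi_x1 (phi_cst i) c.

(** [E i] vanishes on all branches but the i-th, so the conductors of the branches, shifted by the
    orders of the [E i], combine. *)
Lemma curve_conductor : exists n, forall s : 'I_d -> fps K,
  (forall i, vge (s i) n) -> exists f, forall i, phi i f = s i.
Proof.
pose E i := \prod_(j < d | j != i) H j.
have E0 i : phi i (E i) != 0.
  rewrite rmorph_prod; apply/prodf_neq0 => j ji.
  by apply: phi_H_neq0; rewrite eq_sym.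
have Ez i j : j != i -> phi j (E i) = 0.
  move=> ji; apply/phi_ker; rewrite /E (bigD1 j) //=.
  by eexists; rewrite mulrC.
have /choice[b bP] i : exists b, forall s, vge s b -> exists f, phi i f = s.
  exact: (branch_conductor (phi_cst i) (phi_frac i) (x_order i)).
have /choice[o oP] i : exists n, has_order (phi i (E i)) n by apply: has_order_ex.
exists (\sum_i (o i + b i))%N => s sn.
have /choice[F FP] i : exists f, phi i (E i) * phi i f = s i.
  have [|q sE qb] := fps_div (oP i) (s := s i) (k := b i).
    by apply: vgeW (sn i); rewrite (bigD1 i) //= leq_addr.
  by have [f fE] := bP i q qb; exists f; rewrite fE.
exists (\sum_i E i * F i) => i; rewrite rmorph_sum (bigD1 i) //= rmorphM FP.
by rewrite big1 ?addr0 // => j ji; rewrite rmorphM Ez ?mul0r // eq_sym.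
Qed.

(** A high power of y divided by x lies in the conductor. Thus finitely many powers of y generate O
    over K[[x]]. *)
Lemma y_power_x : exists n f, forall i, phi i y ^+ n = phi i x * phi i f.
Proof.
have [b bP] := curve_conductor; pose n := (\sum_i omega i + b)%N.
have /choice[s sP] i : exists s, phi i y ^+ n = phi i x * s /\ vge s b.
  have [|q] := fps_div (x_order i) (s := phi i y ^+ n) (k := b); last by exists q.
  have y1 : vge (phi i y) 1 by exact: (vgeW (omega_gt0 i) (@y_order i)).
  by apply: vgeW (vgeX (n := n) y1); rewrite mul1n leq_add2r (bigD1 i) //= leq_addr.
have [|f fE] := bP s; first by move=> i; case: (sP i).
by exists n, f => i; rewrite fE; case: (sP i).
Qed.

Lemma fps2_split_pow n f : exists (a : nat -> K) f1 f2,
  f = \sum_(k < n) cst (a k) * y ^+ k + x * f1 + y ^+ n * f2.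
Proof.
elim: n => [|n [a [f1 [f2 fE]]]].
  by exists (fun=> 0), 0, f; rewrite big_ord0 mulr0 !add0r mul1r.
have [g1 [g2 gE]] := fps2_split c f2.
exists (fun k => if k == n then const2 f2 else a k), (f1 + y ^+ n * g1), g2.
rewrite {1}fE {1}gE big_ord_recr /= eqxx.
have -> : \sum_(k < n) cst (if val k == n then const2 f2 else a k) * y ^+ k =
    \sum_(k < n) cst (a k) * y ^+ k.
  by apply: eq_bigr => k _; rewrite (ltn_eqF (ltn_ord k)).
rewrite exprSr; move: (\sum_(k < n) _) (y ^+ n) => A t; ring.
Qed.

Definition ev (z : 'I_d -> fps K) i : {rmorphism {poly fps K} -> fps K} :=
  [the {rmorphism {poly fps K} -> fps K} of horner_eval (z i) \o map_poly (subst (x1 i))].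

Lemma evE z i p : ev z i p = (map_poly (subst (x1 i)) p).[z i]. Proof. by []. Qed.

Lemma ev_const z i s : ev z i s%:P = subst (x1 i) s.
Proof. by rewrite evE map_polyC hornerC. Qed.

Lemma ev_X z i : ev z i (constX K) = phi i x.
Proof. by rewrite ev_const substX. Qed.

Lemma ev_addXM z i p q : ev z i (p + 'X * q) = ev z i p + z i * ev z i q.
Proof. by rewrite rmorphD rmorphM [ev z i 'X]evE map_polyX hornerX. Qed.

Lemma ev_scaled z i p : ev (fun k => phi k x * z k) i p = ev z i (p \Po (constX K * 'X)).
Proof.
rewrite !evE map_comp_poly horner_comp /= rmorphM /= map_polyX map_polyC hornerM hornerC.
by rewrite hornerX /= substX.
Qed.

Lemma ev_coef_wide z i n (p : {poly fps K}) : (size p <= n)%N ->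
  ev z i p = \sum_(k < n) subst (x1 i) p`_k * z i ^+ k.
Proof.
move=> pn; rewrite evE (@horner_coef_wide _ n); last exact: leq_trans (size_poly _ _) pn.
by apply: eq_bigr => k _; rewrite coef_map.
Qed.

Lemma phi_of_poly p : exists f, forall i, phi i f = ev (fun k => phi k y) i p.
Proof.
exists (\sum_(k < size p) fps_at c p`_k * y ^+ k) => i.
rewrite (@ev_coef_wide _ i (size p)) // rmorph_sum; apply: eq_bigr => k _.
by rewrite rmorphM rmorphXn (phi_fps_at (phi_cst i) (x1 i)).
Qed.

Lemma poly_of_phi f : exists p, forall i, ev (fun k => phi k y) i p = phi i f.
Proof.
have [n [g gE]] := y_power_x.
pose M (s : 'I_d -> fps K) := exists h, forall i, s i = phi i h.
have [||S SE] := @xadic_expansion K 'I_d n (fun i => phi i x) (fun k i => phi i y ^+ k) M x1 _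
    (fun i => phi i f); last 2 first.
- by exists f.
- exists (\poly_(k < n) if insub k is Some k' then S k' else 0) => i.
  rewrite SE (@ev_coef_wide _ i n) ?size_poly //; apply: eq_bigr => k _.
  by rewrite coef_poly ltn_ord valK.
move=> s [h hE]; have [a [f1 [f2 E]]] := fps2_split_pow n h.
exists (fun k : 'I_n => a k), (fun i => phi i (f1 + g * f2)); split; first by exists (f1 + g * f2).
move=> i; rewrite hE E rmorphD rmorphD rmorphM [phi i (_ ^+ _ * _)]rmorphM rmorphXn gE.
rewrite rmorph_sum -addrA; congr (_ + _); last by rewrite [phi i (f1 + _)]rmorphD [phi i (g * _)]rmorphM mulrDr mulrA.
by apply: eq_bigr => k _; rewrite rmorphM rmorphXn phi_cst.
Qed.

(** The product of monic equations for the single [z i] vanishes on every branch. *)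
Lemma ev_monic z : exists n, monic_deg (fun p => forall i, ev z i p = 0) n.
Proof.
have /choice[P PP] i : exists P, P \is monic /\ ev z i P = 0.
  exact: (series_integral (x_order i) (x1 i) (z i)).
exists (size (\prod_i P i)).-1, (\prod_i P i).
have Pm : \prod_i P i \is monic by apply: monic_prod => i _; case: (PP i).
split=> //; first by rewrite prednK // lt0n size_poly_eq0 monic_neq0.
by move=> i; rewrite (bigD1 i) // rmorphM (PP i).2 mul0r.
Qed.

Lemma parametrization_ev z : (exists n, forall s : 'I_d -> fps K,
    (forall i, vge (s i) n) -> exists p, forall i, ev z i p = s i) ->
  parametrization (ev z) omega.
Proof.
move=> cond; split=> // [i a|i|]; first by rewrite ev_const substC.
  by rewrite ev_X.
exact: ev_monic.
Qed.

Lemma parametrization_curve : parametrization (ev (fun i => phi i y)) omega.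
Proof.
apply: parametrization_ev; have [n nP] := curve_conductor; exists n => s /nP[f fE].
by have [p pE] := poly_of_phi f; exists p => i; rewrite pE.
Qed.

Variable z : 'I_d -> fps K.
Hypothesis zE : forall i, phi i y = phi i x * z i.

Lemma ev_blowup i p : ev (fun i => phi i y) i p = ev z i (p \Po (constX K * 'X)).
Proof. by rewrite -ev_scaled !evE zE. Qed.

Lemma parametrization_blowup : parametrization (ev z) omega.
Proof.
apply: parametrization_ev; have [n nP] := curve_conductor; exists n => s /nP[f fE].
have [p pE] := poly_of_phi f; exists (p \Po (constX K * 'X)) => i.
by rewrite -ev_blowup pE.
Qed.

End Curve.

(** * The total ring of fractions and the blow-up *)

Section CurveRing.
Variables (K : fieldType) (infK : infinite_set [set: K]) (d : nat) (H : 'I_d -> fps2 K).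
Variables (O : comNzRingType) (pi : {rmorphism fps2 K -> O}).
Hypothesis curve : plane_algebroid_curve H pi.
Variable phi : forall i : 'I_d, {rmorphism fps2 K -> fps K}.
Hypothesis normalization : forall i, branch_normalization (H i) (phi i).
Variables (Q : comUnitRingType) (iota : {rmorphism O -> Q}).
Hypothesis fractions : total_fraction_ring iota.
Variable psi : forall i : 'I_d, {rmorphism Q -> laurent K}.
Hypothesis psi_phi : forall i f, psi i (iota (pi f)) = (phi i f)%:F.
Implicit Types (f g : fps2 K) (i : 'I_d) (q u : Q).

Let H_irr i : irreducible_elt (H i). Proof. by case: curve. Qed.
Let H_coprime i j : i != j -> coprime_elt (H i) (H j). Proof. by case: curve => _ + _ _; apply. Qed.
Let pi_surj a : exists f, pi f = a. Proof. by case: curve. Qed.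
Let pi_ker f : pi f = 0 <-> divides (\prod_(i < d) H i) f. Proof. by case: curve. Qed.
Let phi_cst i c : phi i (cst c) = fpsC c. Proof. by case: (normalization i) => + _ _ _; apply. Qed.
Let phi_ker i f : phi i f = 0 <-> divides (H i) f. Proof. by case: (normalization i). Qed.
Let phi_frac i (z : laurent K) : exists f g,
  phi i g != 0 /\ z = (phi i f)%:F / (phi i g)%:F.
Proof. by case: (normalization i) => _ _ + _; apply. Qed.

Lemma pi_eq0 f : (forall i, phi i f = 0) -> pi f = 0.
Proof. by move=> f0; apply/pi_ker; apply: (prod_divides H_irr H_coprime phi_ker). Qed.

Lemma psi_eq0 q : (forall i, psi i q = 0) -> q = 0.
Proof.
move=> q0; have [_ reg_unit /(_ q)[a [b [breg qE]]]] := fractions.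
have [f fa] := pi_surj a.
have aE : iota a = q * iota b by rewrite qE divrK // reg_unit.
rewrite qE -fa pi_eq0 ?rmorph0 ?mul0r // => i.
by apply/eqP; rewrite -tofrac_eq0 -psi_phi fa aE rmorphM q0 mul0r.
Qed.

Lemma psi_inj q u : (forall i, psi i q = psi i u) -> q = u.
Proof.
move=> E; apply/eqP; rewrite -subr_eq0; apply/eqP/psi_eq0 => i.
by rewrite rmorphB E subrr.
Qed.

Lemma value_semigroup_vals (R : set Q) (e : 'I_d -> {rmorphism {poly fps K} -> fps K}) :
  (forall q, R q -> exists p, forall i, psi i q = (e i p)%:F) ->
  (forall p, exists q, R q /\ forall i, psi i q = (e i p)%:F) ->
  value_semigroup psi R = vals e.
Proof.
move=> Re eR; apply/seteqP; split=> a.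
  move=> [q [/Re[p pE] _ qa]]; exists p => i; have [s [qs sa]] := qa i.
  suff -> : e i p = s by [].
  by apply/eqP; rewrite -tofrac_eq -pE qs.
move=> [p pa]; have [q [Rq qE]] := eR p.
have qa : has_value psi q a by move=> i; exists (e i p).
exists q; split=> // r _ qr0; apply: psi_eq0 => i.
have /eqP : psi i (q * r) = 0 by rewrite qr0 rmorph0.
rewrite rmorphM qE mulf_eq0 tofrac_eq0 => /orP[/eqP e0|/eqP//].
by have := has_order_neq0 (pa i); rewrite e0 eqxx.
Qed.

Variable m : set Q.
Hypothesis max_m : maximal_ideal (range iota) m.
Hypothesis d_gt0 : (0 < d)%N.

Lemma const2_prod : const2 (\prod_(i < d) H i) = 0.
Proof.
have h0 : const2 (H (Ordinal d_gt0)) = 0.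
  have [_ /negP nu _] := H_irr (Ordinal d_gt0); apply/eqP; apply: contraT => h0.
  have [g gE] := unit_fps2 h0; case: nu; apply/unitrPr; exists g.
  by rewrite mulrC.
by rewrite (bigD1 (Ordinal d_gt0)) //= const2M h0 mul0r.
Qed.

(** A nonzero constant term makes an element a unit, so [m] lies in this proper ideal. *)
Lemma max_idealE : m = [set u | exists2 f, u = iota (pi f) & const2 f = 0].
Proof.
set m0 := [set u | _]; have [[mR m_0 mD mM] mnR mmax] := max_m.
have one_nm0 : ~ m0 1.
  move=> [f fE f0]; have inj_iota : injective iota by case: fractions.
  have /pi_ker[h hE] : pi (f - 1) = 0.
    by apply: inj_iota; rewrite !rmorphB -fE !rmorph1 subrr rmorph0.
  have /eqP := congr1 (@const2 K) hE.
  rewrite const2M const2_prod mulr0 const2B f0 sub0r oppr_eq0.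
  by rewrite [const2 1](_ : _ = 1) ?oner_eq0 // /const2 !rmorph1.
have m0_ideal : ideal_of (range iota) m0.
  split=> [_ [f -> _]||_ _ [f -> f0] [g -> g0]|_ _ [a _ <-] [f -> f0]].
  - by exists (pi f).
  - by exists 0; rewrite ?rmorph0 // /const2 !rmorph0.
  - by exists (f + g); rewrite ?rmorphD // const2D f0 g0 addr0.
  have [g <-] := pi_surj a.
  by exists (g * f); rewrite ?rmorphM // const2M f0 mulr0.
have m_sub : m `<=` m0.
  move=> u mu; have [a _ ua] := mR u mu; have [f fa] := pi_surj a.
  exists f; first by rewrite fa.
  apply/eqP; apply: contraT => f0; have [g gf] := unit_fps2 f0; case: mnR.
  apply/seteqP; split=> // _ [b _ <-].
  have -> : iota b = iota (b * pi g) * u.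
    by rewrite -ua -fa -rmorphM -mulrA -rmorphM gf rmorph1 mulr1.
  by apply: mM => //; exists (b * pi g).
have [//|m0R] := mmax m0 m0_ideal m_sub.
by case: one_nm0; rewrite m0R; exists 1; rewrite ?rmorph1.
Qed.

Variables (c : K) (omega : {ffun 'I_d -> nat}).
Local Notation x := (vX K + cst c * vY K).
Local Notation y := (vY K).
Hypothesis x_order : forall i, has_order (phi i x) (omega i).
Hypothesis omega_gt0 : forall i, (0 < omega i)%N.
Hypothesis y_order : forall i, vge (phi i y) (omega i).

Local Notation ev := (ev phi_cst c).
Local Notation evy := (ev (fun i => phi i y)).

Lemma range_iota_evy q : range iota q -> exists p, forall i, psi i q = (evy i p)%:F.
Proof.
move=> [a _ <-]; have [f <-] := pi_surj a.
have [p pE] := poly_of_phi H_irr H_coprime phi_cst phi_ker phi_frac x_order omega_gt0 y_order f.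
by exists p => i; rewrite psi_phi pE.
Qed.

Lemma evy_range_iota p : exists q, range iota q /\ forall i, psi i q = (evy i p)%:F.
Proof.
have [f fE] := phi_of_poly phi_cst c p.
by exists (iota (pi f)); split=> [|i]; [exists (pi f)|rewrite psi_phi fE].
Qed.

(** Every nonunit is a combination of x and y, so [omega] lies below its value. *)
Lemma minimal_nonzero_omega w :
  minimal_nonzero (value_semigroup psi (range iota)) w -> w = omega.
Proof.
move=> [[q [[a _ aq] _ qw]] w0 wmin]; have [f fa] := pi_surj a; apply/esym/wmin.
- rewrite (value_semigroup_vals range_iota_evy evy_range_iota).
  by exists (constX K) => i; rewrite ev_X.
- move=> o0; have := omega_gt0 (Ordinal d_gt0).
  by rewrite o0 ffunE.
have fw i : has_order (phi i f) (w i).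
  have [s [qs sw]] := qw i; suff -> : phi i f = s by [].
  by apply/eqP; rewrite -tofrac_eq -psi_phi fa aq qs.
have f0 : const2 f = 0.
  apply/eqP; apply: contraT => f0; case: w0; apply/ffunP => i.
  apply: has_order_inj (fw i) _; rewrite ffunE; split=> //; apply/eqP.
  by rewrite -[fcoef _ 0]/(fconst _) (phi_const (phi_cst i)).
have [f1 [f2 fE]] := fps2_split c f.
move=> i; apply: vge_has_order (fw i).
rewrite fE f0 cst0 add0r rmorphD !rmorphM; apply: vgeD; rewrite mulrC; apply: vgeMl => //.
exact: has_order_vge.
Qed.

Variable z : 'I_d -> fps K.
Hypothesis zE : forall i, phi i y = phi i x * z i.
Local Notation evz := (ev z).
Local Notation R := (range iota).

(** m^n lies in x^n B(O), because m = (x, y) and y = xz. *)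
Lemma ideal_pow_evz n u : ideal_pow R m n u ->
  exists p, forall i, psi i u = (phi i x ^+ n * evz i p)%:F.
Proof.
elim: n u => [|n IH] u /=.
  move=> /range_iota_evy[p pE]; exists (p \Po (constX K * 'X)) => i.
  by rewrite pE (ev_blowup phi_cst zE) mul1r.
move=> [k [a [b [ab ->]]]].
have /choice[p pE] (j : 'I_k) : exists p, forall i, psi i (a j * b j) = (phi i x ^+ n.+1 * evz i p)%:F.
  have [ma /IH[p pE]] := ab j; move: ma; rewrite max_idealE => -[f aE f0].
  have [f1 [f2 fE]] := fps2_split c f.
  have Rf g : range iota (iota (pi g)) by exists (pi g).
  have [p1 p1E] := range_iota_evy (Rf f1); have [p2 p2E] := range_iota_evy (Rf f2).
  exists ((p1 \Po (constX K * 'X) + 'X * (p2 \Po (constX K * 'X))) * p) => i.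
  rewrite rmorphM pE aE psi_phi -rmorphM; congr tofrac.
  have phiE g p' : (forall i, psi i (iota (pi g)) = (evy i p')%:F) ->
      phi i g = evz i (p' \Po (constX K * 'X)).
    move=> gE; rewrite -(ev_blowup phi_cst zE); apply/eqP.
    by rewrite -tofrac_eq -psi_phi gE.
  rewrite [evz i (_ * p)]rmorphM ev_addXM -(phiE f1 p1) // -(phiE f2 p2) // fE f0 cst0 add0r.
  rewrite [phi i (_ + _)]rmorphD [phi i (x * _)]rmorphM [phi i (y * _)]rmorphM zE exprS.
  ring.
exists (\sum_j p j) => i; rewrite !rmorph_sum mulr_sumr rmorph_sum.
by apply: eq_bigr => j _; rewrite pE.
Qed.

(** For k at most n, x^n z^k = x^(n-k) y^k lies in m^n. *)
Lemma evz_ideal_pow n (r : {poly fps K}) : (size r <= n.+1)%N -> exists u,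
  ideal_pow R m n u /\ forall i, psi i u = (phi i x ^+ n * evz i r)%:F.
Proof.
elim: n r => [|n IH] r rn.
  have [s ->] : exists s, r = s%:P by exists r`_0; apply: size1_polyC.
  exists (iota (pi (fps_at c s))); split; first by exists (pi (fps_at c s)).
  by move=> i; rewrite psi_phi mul1r ev_const (phi_fps_at (phi_cst i) (phi_x1 (phi_cst i) c)).
have [|u0 [mu0 u0E]] := IH (take_poly 1 r).
  by apply: leq_trans (size_take_poly 1 r) _.
have [|u1 [mu1 u1E]] := IH (drop_poly 1 r); first by rewrite size_drop_poly; lia.
exists (iota (pi x) * u0 + iota (pi y) * u1); split.
  exists 2, (fun k : 'I_2 => if val k == 0 then iota (pi x) else iota (pi y)),
    (fun k : 'I_2 => if val k == 0 then u0 else u1); split; last by rewrite !big_ord_recl big_ord0 addr0.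
  move=> k; case: ifP => _; split=> //; rewrite max_idealE.
    exists x => //; rewrite /const2 /fconst fcoefD fcoefM_0 fcoefD fcoefM_0 /=.
    by rewrite mulr0 addr0.
  by exists y.
move=> i; rewrite rmorphD !rmorphM !psi_phi u0E u1E -!rmorphM -rmorphD; congr tofrac.
have rE : r = take_poly 1 r + 'X * drop_poly 1 r.
  by rewrite -{1}(poly_take_drop 1 r) expr1 mulrC.
by rewrite {3}rE ev_addXM zE exprS; ring.
Qed.

(** x^n lies in m^n, so q x^n lies in m^n and hence in x^n K[[x]][z]. *)
Lemma blowup_evz q : blowup R m q -> exists p, forall i, psi i q = (evz i p)%:F.
Proof.
move=> [n _ qn]; have [|u [mu uE]] := @evz_ideal_pow n 1; first by rewrite size_poly1.
have [p pE] := ideal_pow_evz (qn u mu); exists p => i.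
have x0 : (phi i x ^+ n)%:F != 0 :> laurent K.
  by rewrite tofrac_eq0 expf_neq0 // (has_order_neq0 (x_order i)).
apply: (mulIf x0); have := pE i.
by rewrite [psi i (q * u)]rmorphM uE rmorph1 mulr1 => ->; rewrite rmorphM mulrC.
Qed.

(** A monic equation of degree n for z bounds degrees in z, so m^n = x^n K[[x]][z] for this n, which
    is stable under multiplication by p(z). *)
Lemma evz_blowup p : exists q, blowup R m q /\ forall i, psi i q = (evz i p)%:F.
Proof.
have [n [P [Pm sP P0]]] := ev_monic phi_cst x_order z.
have reduce r : exists r' : {poly fps K}, (size r' <= n.+1)%N /\ forall i, evz i r = evz i r'.
  have [u [r' [-> sr]]] := monic_division r Pm; exists r'; split; first by rewrite -sP ltnW.
  by move=> i; rewrite rmorphD rmorphM P0 mulr0 add0r.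
have [r [sr pr]] := reduce p; have [u [mu uE]] := evz_ideal_pow sr.
have x0 i : (phi i x)%:F != 0 :> laurent K by rewrite tofrac_eq0 (has_order_neq0 (x_order i)).
have xu : iota (pi x) \is a GRing.unit.
  have [inj_iota reg_unit _] := fractions; apply: reg_unit => a b ab.
  apply/inj_iota/psi_inj => i; apply: (mulfI (x0 i)).
  by rewrite -psi_phi -!rmorphM ab.
exists (u / iota (pi x) ^+ n).
have qE i : psi i (u / iota (pi x) ^+ n) = (evz i p)%:F.
  apply: (mulIf (expf_neq0 n (x0 i))).
  have <- : psi i u = psi i (u / iota (pi x) ^+ n) * (phi i x)%:F ^+ n.
    by rewrite -psi_phi -(rmorphXn (psi i)) -rmorphM divrK ?unitrX.
  by rewrite uE rmorphM rmorphXn pr mulrC.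
split=> //; exists n => // v mv; have [pv pvE] := ideal_pow_evz mv.
have [r' [sr' rr']] := reduce (p * pv); have [w [mw wE]] := evz_ideal_pow sr'.
suff -> : u / iota (pi x) ^+ n * v = w by [].
apply: psi_inj => i; rewrite [psi i (_ * v)]rmorphM qE pvE wE -rr' -tofracM.
by congr tofrac; rewrite [evz i (p * pv)]rmorphM mulrCA.
Qed.

Lemma level_curve (i : nat) : (i < \sum_(k < d) omega k)%N ->
  level (value_semigroup psi R) omega i =
  [set a + omega *+ i | a in level (value_semigroup psi (blowup R m)) omega i].
Proof.
rewrite (value_semigroup_vals range_iota_evy evy_range_iota).
rewrite (value_semigroup_vals blowup_evz evz_blowup).
apply: level_blowup => //; last by move=> l p; apply: ev_blowup.
  exact: (parametrization_blowup H_irr H_coprime phi_cst phi_ker phi_frac x_order omega_gt0 y_order zE).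
exact: (parametrization_curve H_irr H_coprime phi_cst phi_ker phi_frac x_order omega_gt0 y_order).
Qed.

End CurveRing.

Theorem theorem4p15 (K : fieldType) (infK : infinite_set [set: K])
  (d : nat) (H : 'I_d -> fps2 K)
  (O : comNzRingType) (pi : {rmorphism fps2 K -> O})
  (curve : plane_algebroid_curve H pi)
  (phi : forall i : 'I_d, {rmorphism fps2 K -> fps K})
  (normalization : forall i, branch_normalization (H i) (phi i))
  (Q : comUnitRingType) (iota : {rmorphism O -> Q})
  (fractions : total_fraction_ring iota)
  (psi : forall i : 'I_d, {rmorphism Q -> laurent K})
  (psi_phi : forall i f, psi i (iota (pi f)) = (phi i f)%:F)
  (m : set Q) (max_m : maximal_ideal (range iota) m)
  (nonlocal : ~ local_ring (blowup (range iota) m))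
  (omega : {ffun 'I_d -> nat})
  (min_omega : minimal_nonzero (value_semigroup psi (range iota)) omega) :
  forall i : nat, (i < \sum_(k < d) omega k)%N ->
    level (value_semigroup psi (range iota)) omega i =
    [set alpha + omega *+ i | alpha in
       level (value_semigroup psi (blowup (range iota) m)) omega i].
Proof.
move=> i iN; have d0 : (0 < d)%N.
  by case: (posnP d) => // d0; move: iN; rewrite big1 // => k; have := ltn_ord k; rewrite {2}d0.
have [H_irr H_coprime _ _] := curve.
have phi_cst j c : phi j (cst c) = fpsC c by case: (normalization j) => + _ _ _; apply.
have phi_ker j f : phi j f = 0 <-> divides (H j) f by case: (normalization j).
have phi_frac j (z : laurent K) : exists f g, phi j g != 0 /\ z = (phi j f)%:F / (phi j g)%:F.
  by case: (normalization j) => _ _ + _; apply.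
have [c [w wP]] := exists_transversal infK phi_cst phi_frac.
have w0 j : (0 < w j)%N by case: (wP j).
have xw j : has_order (phi j (vX K + cst c * vY K)) (w j) by case: (wP j).
have yw j : vge (phi j (vY K)) (w j) by case: (wP j).
have /choice[z zP] j : exists s, phi j (vY K) = phi j (vX K + cst c * vY K) * s.
  by have [|s sE _] := fps_div (xw j) (s := phi j (vY K)) (k := 0); [rewrite addn0|exists s].
have omegaE : omega = w.
  exact: (minimal_nonzero_omega curve normalization fractions psi_phi d0 xw w0 yw min_omega).
rewrite omegaE in iN *.
exact: (level_curve infK curve normalization fractions psi_phi max_m d0 xw w0 yw zP iN).
Qed.
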